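(* Let $n\ge 1$ and let $P_1(z)=a_nz^n+a_{n-1}z^{n-1}+\cdots+a_0$ and $P_0(z)=b_nz^n+b_{n-1}z^{n-1}+\cdots+b_0$ be non-constant polynomials with complex coefficients, $a_n\neq 0$, $b_n\neq 0$. Let $h_1$ and $h_0$ be entire functions, not identically zero, satisfying $\rho(h_1)<\deg P_1$ and $\rho(h_0)<\deg P_0$. Suppose that $P_1(z)-cP_0(z)$ is a constant for some real $c\geq 1$, and that $\rho(h_1)<\mu(h_0)\leq \frac{1}{2}$. Then every non-trivial solution $f$ of the differential equation $$f''+h_1(z)e^{P_1(z)}f'+h_0(z)e^{P_0(z)}f=0$$ is of infinite order.
   Context: All solutions of this equation are entire functions. For an entire function $g$, with $M(r,g)=\max_{|z|=r}|g(z)|$, the order is $\rho(g)=\limsup_{r\to\infty}\frac{\log^+\log^+ M(r,g)}{\log r}$ and the lower order is $\mu(g)=\liminf_{r\to\infty}\frac{\log^+\log^+ M(r,g)}{\log r}$. A solution is non-trivial if it is not identically zero; it has infinite order if $\rho(f)=\infty$. *)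

(* Defs.v *)
From Stdlib Require Import Reals.
From Coquelicot Require Export Coquelicot.

Open Scope C_scope.

Definition cexp (z : C) : C :=
  (exp (Re z) * cos (Im z), exp (Re z) * sin (Im z))%R.

Definition peval (a : nat -> C) (n : nat) (z : C) : C :=
  sum_n (fun k => a k * pow_n z k) n.

Definition entire (g : C -> C) : Prop := forall z : C, ex_derive g z.

(* M(r,g) = max_{|z|=r} |g(z)| (as supremum; attained for continuous g) *)
Definition maxmod (g : C -> C) (r : R) : R :=
  real (Lub_Rbar (fun y => exists z : C, Cmod z = r /\ y = Cmod (g z))).

Definition logp (x : R) : R := Rmax (ln x) 0.

Definition ord_ratio (g : C -> C) (r : R) : R :=
  (logp (logp (maxmod g r)) / ln r)%R.

Definition limsup_inf (F : R -> R) : Rbar :=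
  Glb_Rbar (fun x => exists R0 : R,
    Lub_Rbar (fun y => exists r, (R0 <= r)%R /\ y = F r) = Finite x).

Definition liminf_inf (F : R -> R) : Rbar :=
  Lub_Rbar (fun x => exists R0 : R,
    Glb_Rbar (fun y => exists r, (R0 <= r)%R /\ y = F r) = Finite x).

Definition order (g : C -> C) : Rbar := limsup_inf (ord_ratio g).
Definition lower_order (g : C -> C) : Rbar := liminf_inf (ord_ratio g).

(* Main.v *)
Require Import Defs.
From Stdlib Require Import Reals Lra Lia ClassicalEpsilon.
From Coquelicot Require Import Coquelicot.

(* Suppose [f] has finite order.  On the strip [|Re P0| <= 1] the factor [exp P0] is bounded above
   and below and [exp P1] is bounded, so there [h1 exp P1] has size at most [exp (|z| ^ s)] for
   every [s] above the order of [h1].  On a disc where [h0] is much larger than that, Cauchy's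
   estimates in [f = - (f'' + h1 exp P1 f') / (h0 exp P0)] make [f] shrink by a factor 2 on each
   slightly smaller disc; after exponentially many steps [f] is so small that Hadamard's three
   circles theorem contradicts finite order.  Hence [h0] is moderate at a very fine net of points
   of the strip, and, by Cauchy's estimates again, on the whole strip.  Since the order of [h0] is
   less than the degree of [P0], the Phragmen-Lindelof principle in [Re P0 > 1] and in
   [Re P0 < - 1] extends the bound [exp (K |z| ^ s)] to the whole plane, so the lower order of
   [h0] is at most the order of [h1]. *)

Open Scope R_scope.

(** The function [h0] may vanish, so no pointwise lower bound for it is available; a contradiction
    can only show that it is moderate somewhere in every tiny disc, and a second contraction must
    fill the gaps of that net. All scales at modulus [r] are powers of [X = exp (r ^ a)] with
    [s1 < a < s2]: [X] beats every power of [r] and the coefficient [h1 exp P1] on the strip, while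
    [X ^ 10] stays below [exp (r ^ s2)]. About [X ^ 2 / 4] halvings of [f] fit into a disc of radius
    [X ^ (-2)], so [f] would be doubly exponentially small there; three circles allow only about
    [exp (- r ^ (rho + a))]. The bound 1/2 on the lower order keeps the exponent [s2] below the
    degree, as the Phragmén-Lindelöf step requires. The complex analysis rests on one chain: Goursat
    on rectangles, the mean value of real parts, the maximum principle. Cauchy's estimate comes from
    the maximum principle for difference quotients, at the price of a harmless factor 2. *)

Lemma Cmod_minus_sym (z w : C) : Cmod (z - w) = Cmod (w - z).
Proof. rewrite <- Cmod_opp. f_equal. ring. Qed.

Lemma Cmod_minus_triangle (x y z : C) : Cmod (x - z) <= Cmod (x - y) + Cmod (y - z).
Proof. replace (x - z)%C with ((x - y) + (y - z))%C by ring. apply Cmod_triangle. Qed.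

Lemma Cmod_le_minus (x y : C) : Cmod x <= Cmod y + Cmod (x - y).
Proof. replace x with (y + (x - y))%C at 1 by ring. apply Cmod_triangle. Qed.

Lemma im_le_Cmod (z : C) : Rabs (Im z) <= Cmod z.
Proof. apply Rle_trans with (2 := Rmax_Cmod z). apply Rmax_r. Qed.

Lemma Re_minus (z w : C) : Re (z - w) = Re z - Re w.
Proof. reflexivity. Qed.

Lemma Im_minus (z w : C) : Im (z - w) = Im z - Im w.
Proof. reflexivity. Qed.

Lemma Re_mult (z w : C) : Re (z * w) = Re z * Re w - Im z * Im w.
Proof. reflexivity. Qed.

Lemma Im_mult (z w : C) : Im (z * w) = Re z * Im w + Im z * Re w.
Proof. reflexivity. Qed.

Lemma Cmod_le_ReIm (z : C) : Cmod z <= Rabs (Re z) + Rabs (Im z).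
Proof.
  replace z with (RtoC (Re z) + (0, Im z))%C at 1.
  - apply Rle_trans with (1 := Cmod_triangle _ _). rewrite Cmod_R.
    apply Rplus_le_compat_l.
    replace (0, Im z) with (RtoC (Im z) * Ci)%C.
    + rewrite Cmod_mult, Cmod_R, Cmod_Ci. lra.
    + unfold RtoC, Ci, Cmult; simpl. f_equal; ring.
  - destruct z; unfold RtoC, Cplus; simpl. f_equal; ring.
Qed.

(** * Continuity and differentiability in Carathéodory form *)

Definition cont (F : C -> C) (z : C) : Prop :=
  forall eps, 0 < eps -> exists del, 0 < del /\
    forall w, Cmod (w - z) < del -> Cmod (F w - F z) < eps.

(** [q] is the difference quotient, continued to [z] by the derivative. Rules of differentiation
    become algebraic identities, and [q] is itself the function to which the maximum principle is
    applied in Cauchy's estimate. *)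
Definition slope (F q : C -> C) (z : C) : Prop :=
  cont q z /\ forall w, (F w - F z = q w * (w - z))%C.

Definition cdiff (F : C -> C) (z : C) : Prop := exists q, slope F q z.

Lemma cont_const (k z : C) : cont (fun _ => k) z.
Proof.
  intros e He. exists 1. split; [lra|]. intros w _.
  replace (k - k)%C with (RtoC 0) by ring. rewrite Cmod_0. exact He.
Qed.

Lemma cont_id (z : C) : cont (fun w => w) z.
Proof. intros e He. exists e. auto. Qed.

Lemma cont_plus (F G : C -> C) (z : C) :
  cont F z -> cont G z -> cont (fun w => F w + G w)%C z.
Proof.
  intros HF HG e He.
  destruct (HF (e/2)) as (d1 & D1 & H1); [lra|].
  destruct (HG (e/2)) as (d2 & D2 & H2); [lra|].
  exists (Rmin d1 d2). split; [now apply Rmin_glb_lt|]. intros w Hw.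
  specialize (H1 w (Rlt_le_trans _ _ _ Hw (Rmin_l _ _))).
  specialize (H2 w (Rlt_le_trans _ _ _ Hw (Rmin_r _ _))).
  replace (F w + G w - (F z + G z))%C with ((F w - F z) + (G w - G z))%C by ring.
  apply Rle_lt_trans with (1 := Cmod_triangle _ _). lra.
Qed.

Lemma cont_mult (F G : C -> C) (z : C) :
  cont F z -> cont G z -> cont (fun w => F w * G w)%C z.
Proof.
  intros HF HG e He.
  set (M := Cmod (F z) + Cmod (G z) + 1).
  assert (HM : 1 <= M) by (unfold M; generalize (Cmod_ge_0 (F z)) (Cmod_ge_0 (G z)); lra).
  assert (HeM : 0 < e / (2 * M)) by (apply Rdiv_lt_0_compat; lra).
  destruct (HF (e / (2 * M))) as (d1 & D1 & H1); [lra|].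
  destruct (HG (Rmin 1 (e / (2 * M)))) as (d2 & D2 & H2); [apply Rmin_glb_lt; lra|].
  exists (Rmin d1 d2). split; [now apply Rmin_glb_lt|]. intros w Hw.
  specialize (H1 w (Rlt_le_trans _ _ _ Hw (Rmin_l _ _))).
  specialize (H2 w (Rlt_le_trans _ _ _ Hw (Rmin_r _ _))).
  assert (Hg1 := Rlt_le_trans _ _ _ H2 (Rmin_l _ _)).
  assert (Hg2 := Rlt_le_trans _ _ _ H2 (Rmin_r _ _)).
  replace (F w * G w - F z * G z)%C
    with ((F w - F z) * G w + F z * (G w - G z))%C by ring.
  apply Rle_lt_trans with (1 := Cmod_triangle _ _). rewrite !Cmod_mult.
  assert (HGw : Cmod (G w) <= M).
  { apply Rle_trans with (1 := Cmod_le_minus _ (G z)). unfold M.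
    generalize (Cmod_ge_0 (F z)). lra. }
  assert (HFz : Cmod (F z) <= M) by (unfold M; generalize (Cmod_ge_0 (G z)); lra).
  assert (E : e = e / (2 * M) * M + M * (e / (2 * M))) by (field; lra).
  rewrite E.
  generalize (Cmod_ge_0 (F z)) (Cmod_ge_0 (G w)) (Cmod_ge_0 (F w - F z))
    (Cmod_ge_0 (G w - G z)); intros.
  assert (Cmod (F w - F z) * Cmod (G w) <= Cmod (F w - F z) * M) by nra.
  assert (Cmod (F w - F z) * M < e / (2 * M) * M) by (apply Rmult_lt_compat_r; lra).
  assert (Cmod (F z) * Cmod (G w - G z) <= M * (e / (2 * M))) by (apply Rmult_le_compat; lra).
  lra.
Qed.

Lemma cont_comp (F G : C -> C) (z : C) :
  cont G z -> cont F (G z) -> cont (fun w => F (G w)) z.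
Proof.
  intros HG HF e He. destruct (HF e He) as (d & D & H).
  destruct (HG d D) as (d' & D' & H'). exists d'. split; auto.
Qed.

Lemma cont_inv (z : C) : z <> 0%C -> cont Cinv z.
Proof.
  intros Hz e He. apply Cmod_gt_0 in Hz as Hm. set (m := Cmod z) in *.
  exists (Rmin (m / 2) (e * m * m / 2)).
  split. { apply Rmin_glb_lt; [lra|]. assert (0 < e * m) by nra. nra. }
  intros w Hw.
  assert (H1 := Rlt_le_trans _ _ _ Hw (Rmin_l _ _)).
  assert (H2 := Rlt_le_trans _ _ _ Hw (Rmin_r _ _)).
  assert (Hwm : m / 2 < Cmod w).
  { generalize (Cmod_le_minus z w). rewrite Cmod_minus_sym. fold m. lra. }
  assert (Hw0 : w <> 0%C) by (apply Cmod_gt_0; lra).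
  replace (/ w - / z)%C with ((z - w) * (/ w * / z))%C by (field; auto).
  rewrite !Cmod_mult, !Cmod_inv, Cmod_minus_sym by auto. fold m.
  apply Rlt_le_trans with (e * m * m / 2 * (/ Cmod w * / m)).
  - apply Rmult_lt_compat_r; [|exact H2].
    apply Rmult_lt_0_compat; apply Rinv_0_lt_compat; lra.
  - assert (/ Cmod w <= / (m / 2)) by (apply Rinv_le_contravar; lra).
    replace e with (e * m * m / 2 * (/ (m / 2) * / m)) at 2 by (field; lra).
    apply Rmult_le_compat_l. { assert (0 < e * m) by nra. nra. }
    apply Rmult_le_compat_r; [left; apply Rinv_0_lt_compat; lra|exact H].
Qed.

Lemma cont_ext (F G : C -> C) (z : C) :
  (exists d, 0 < d /\ forall w, Cmod (w - z) < d -> F w = G w) -> cont F z -> cont G z.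
Proof.
  intros (d & D & E) HF e He. destruct (HF e He) as (d' & D' & H).
  exists (Rmin d d'). split; [now apply Rmin_glb_lt|]. intros w Hw.
  rewrite <- !E.
  - apply H. apply Rlt_le_trans with (1 := Hw). apply Rmin_r.
  - replace (z - z)%C with (RtoC 0) by ring. now rewrite Cmod_0.
  - apply Rlt_le_trans with (1 := Hw). apply Rmin_l.
Qed.

Lemma slope_cont (F q : C -> C) (z : C) : slope F q z -> cont F z.
Proof.
  intros (Hq & E).
  apply cont_ext with (fun w => F z + q w * (w + (- z)))%C.
  - exists 1. split; [lra|]. intros w _.
    replace (F w) with (F z + (F w - F z))%C by ring. rewrite E. ring.
  - apply cont_plus; [apply cont_const|]. apply cont_mult; [exact Hq|].
    apply cont_plus; [apply cont_id|apply cont_const].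
Qed.

Lemma cdiff_cont (F : C -> C) (z : C) : cdiff F z -> cont F z.
Proof. intros (q & Hq). now apply slope_cont in Hq. Qed.

Lemma cdiff_const (k z : C) : cdiff (fun _ => k) z.
Proof. exists (fun _ => 0%C). split; [apply cont_const|]. intros; ring. Qed.

Lemma cdiff_id (z : C) : cdiff (fun w => w) z.
Proof. exists (fun _ => 1%C). split; [apply cont_const|]. intros; ring. Qed.

Lemma cdiff_plus (F G : C -> C) (z : C) :
  cdiff F z -> cdiff G z -> cdiff (fun w => F w + G w)%C z.
Proof.
  intros (p & Hp & Ep) (q & Hq & Eq). exists (fun w => p w + q w)%C.
  split; [now apply cont_plus|]. intros w.
  replace (F w + G w - (F z + G z))%C with ((F w - F z) + (G w - G z))%C by ring.
  rewrite Ep, Eq. ring.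
Qed.

Lemma cdiff_mult (F G : C -> C) (z : C) :
  cdiff F z -> cdiff G z -> cdiff (fun w => F w * G w)%C z.
Proof.
  intros HF HG. assert (CG := cdiff_cont _ _ HG).
  destruct HF as (p & Hp & Ep), HG as (q & Hq & Eq).
  exists (fun w => p w * G w + F z * q w)%C.
  split.
  - apply cont_plus; apply cont_mult; auto using cont_const.
  - intros w.
    replace (F w * G w - F z * G z)%C
      with ((F w - F z) * G w + F z * (G w - G z))%C by ring.
    rewrite Ep, Eq. ring.
Qed.

Lemma cdiff_comp (F G : C -> C) (z : C) :
  cdiff G z -> cdiff F (G z) -> cdiff (fun w => F (G w)) z.
Proof.
  intros HG (p & Hp & Ep). assert (CG := cdiff_cont _ _ HG).
  destruct HG as (q & Hq & Eq).
  exists (fun w => p (G w) * q w)%C. split.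
  - apply cont_mult; [|exact Hq]. now apply cont_comp.
  - intros w. rewrite Ep, Eq. ring.
Qed.

Lemma cdiff_ext (F G : C -> C) (z : C) :
  (forall w, F w = G w) -> cdiff F z -> cdiff G z.
Proof.
  intros E (q & Hq & H). exists q. split; [exact Hq|].
  intros w. now rewrite <- !E.
Qed.

(** Away from [z] the plain difference quotient satisfies the factorisation, so [q] matters only
    near [z]. *)
Lemma slope_local (F q : C -> C) (z : C) :
  cont q z ->
  (exists d, 0 < d /\ forall w, Cmod (w - z) < d -> (F w - F z = q w * (w - z))%C) ->
  cdiff F z.
Proof.
  intros Hq (d & D & E).
  set (q' := fun w => if Rlt_dec (Cmod (w - z)) d then q w else ((F w - F z) / (w - z))%C).
  exists q'. split.
  - apply cont_ext with (2 := Hq). exists d. split; [exact D|].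
    intros w Hw. unfold q'. destruct (Rlt_dec _ _); [reflexivity|contradiction].
  - intros w. unfold q'. destruct (Rlt_dec _ _) as [H|H]; [now apply E|].
    field. intros K. rewrite K, Cmod_0 in H. contradiction.
Qed.

Lemma cdiff_inv (z : C) : z <> 0%C -> cdiff Cinv z.
Proof.
  intros Hz. apply slope_local with (q := fun w => (- / z * / w)%C).
  - apply cont_mult; [apply cont_const|now apply cont_inv].
  (* The identity fails at [w = 0], where the inverse is a default value; this radius excludes that
     point. *)
  - exists (Cmod z). split; [now apply Cmod_gt_0|]. intros w Hw.
    assert (w <> 0%C).
    { intros E. subst. rewrite Cmod_minus_sym in Hw. unfold Cminus in Hw.
      replace (z + - 0)%C with z in Hw by ring. lra. }
    field. auto.
Qed.

Lemma cdiff_pow (F : C -> C) (z : C) (q : nat) : cdiff F z -> cdiff (fun w => F w ^ q)%C z.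
Proof.
  intros H. induction q as [|q IH]; simpl.
  - apply cdiff_const.
  - now apply cdiff_mult.
Qed.

Lemma slope_of_derivative (F : C -> C) (z l : C) :
  (forall eps, 0 < eps -> exists del, 0 < del /\ forall w, Cmod (w - z) < del ->
     Cmod (F w - F z - (w - z) * l) <= eps * Cmod (w - z)) ->
  exists q, slope F q z /\ q z = l.
Proof.
  intros H.
  exists (fun w => if Ceq_dec w z then l else ((F w - F z) / (w - z))%C).
  assert (D : forall w, w <> z -> (w - z)%C <> 0%C).
  { intros w Hw K. apply Hw. replace w with ((w - z) + z)%C by ring. rewrite K. ring. }
  split; [split|].
  - intros e He. destruct (H (e / 2)) as (d & Hd0 & Hd); [lra|].
    exists d. split; [exact Hd0|].
    intros w Hw. destruct (Ceq_dec z z) as [_|]; [|contradiction].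
    destruct (Ceq_dec w z) as [_|Hne].
    + replace (l - l)%C with (RtoC 0) by ring. now rewrite Cmod_0.
    + assert (K := Hd w Hw).
      assert (Hp := proj1 (Cmod_gt_0 _) (D w Hne)).
      replace ((F w - F z) / (w - z) - l)%C
        with ((F w - F z - (w - z) * l) / (w - z))%C by (field; auto).
      rewrite Cmod_div by auto.
      apply Rle_lt_trans with (e / 2); [|lra].
      apply Rmult_le_reg_r with (Cmod (w - z)); [exact Hp|].
      unfold Rdiv at 1. rewrite Rmult_assoc, Rinv_l, Rmult_1_r; [exact K|lra].
  - intros w. destruct (Ceq_dec w z) as [->|Hne]; [ring|]. field. auto.
  - destruct (Ceq_dec z z); [reflexivity|contradiction].
Qed.

Lemma is_derive_slope (F : C -> C) (z l : C) :
  is_derive F z l -> exists q, slope F q z /\ q z = l.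
Proof.
  intros (_ & H). apply slope_of_derivative. intros e He.
  (* The library's derivative speaks of every limit of the filter [locally z]; the identity function
     proves that [z] is one. *)
  destruct (H z (fun P HP => HP) (mkposreal _ He)) as (d & Hd).
  exists d. split; [apply cond_pos|exact Hd].
Qed.

Lemma ex_derive_cdiff (F : C -> C) (z : C) :
  @ex_derive C_AbsRing C_NormedModule F z -> cdiff F z.
Proof.
  intros (l & Hl). destruct (is_derive_slope _ _ _ Hl) as (q & Hq & _). now exists q.
Qed.

(** * Bisection and the extreme value theorem *)

Lemma nested_point (x a : nat -> R) :
  (forall k, x k <= x (S k) /\ x (S k) + a (S k) <= x k + a k) ->
  (forall k, 0 <= a k) ->
  exists p, forall k, x k <= p <= x k + a k.
Proof.
  intros H Ha.
  assert (mono : forall j k, (j <= k)%nat -> x j <= x k /\ x k + a k <= x j + a j).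
  { intros j k Hjk. induction Hjk as [|k _ IH]; [lra|]. specialize (H k). lra. }
  assert (cross : forall j k, x j <= x k + a k).
  { intros j k. destruct (Nat.le_ge_cases j k) as [L|L]; apply mono in L;
      generalize (Ha j) (Ha k); lra. }
  destruct (completeness (fun t => exists k, t = x k)) as (p & Hub & Hlub).
  - exists (x 0%nat + a 0%nat). intros t (k & ->). apply cross.
  - exists (x 0%nat), 0%nat. reflexivity.
  - exists p. intros k. split.
    + apply Hub. now exists k.
    + apply Hlub. intros t (j & ->). apply cross.
Qed.

(** If [P] failed, some quarter would fail at every stage, and the nested failing rectangles would
    shrink to a point contradicting the local hypothesis. This serves both as compactness (extreme
    values) and as Goursat's subdivision. Only rectangles of the original shape, scaled by powers of
    1/2, need to be treated locally. *)
Lemma bisection (P : R -> R -> R -> R -> Prop) (x0 y0 a0 b0 : R) :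
  0 < a0 -> 0 < b0 ->
  (forall x y a b, 0 < a -> 0 < b ->
    P x y (a/2) (b/2) -> P (x + a/2) y (a/2) (b/2) ->
    P x (y + b/2) (a/2) (b/2) -> P (x + a/2) (y + b/2) (a/2) (b/2) -> P x y a b) ->
  (forall p q, exists del, 0 < del /\ forall x y k,
    x <= p <= x + a0 / 2 ^ k -> y <= q <= y + b0 / 2 ^ k ->
    a0 / 2 ^ k < del -> b0 / 2 ^ k < del -> P x y (a0 / 2 ^ k) (b0 / 2 ^ k)) ->
  P x0 y0 a0 b0.
Proof.
  intros Ha Hb Hadd Hloc. apply NNPP. intros Hbad.
  assert (pow2 : forall k, 0 < 2 ^ k) by (intros; apply pow_lt; lra).
  assert (half : forall c k, c / 2 ^ k / 2 = c / 2 ^ S k)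
    by (intros; simpl; field; generalize (pow2 k); lra).
  assert (pos : forall c k, 0 < c -> 0 < c / 2 ^ k)
    by (intros; apply Rdiv_lt_0_compat; auto).
  (* The fourth quarter is not tested: if the other three satisfy [P], additivity forces this one to
     fail. *)
  pose (next := fun k (s : R * R) => let a := a0 / 2 ^ k in let b := b0 / 2 ^ k in
    let (x, y) := s in
    if excluded_middle_informative (P x y (a/2) (b/2)) then
    if excluded_middle_informative (P (x + a/2) y (a/2) (b/2)) then
    if excluded_middle_informative (P x (y + b/2) (a/2) (b/2)) then (x + a/2, y + b/2)
    else (x, y + b/2) else (x + a/2, y) else (x, y)).
  pose (s := fix s k := match k with O => (x0, y0) | S j => next j (s j) end).
  assert (Hs : forall k, ~ P (fst (s k)) (snd (s k)) (a0 / 2 ^ k) (b0 / 2 ^ k)).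
  { induction k as [|k IH].
    - simpl. rewrite !Rdiv_1_r. exact Hbad.
    - rewrite <- !half. simpl. destruct (s k) as [x y]. simpl in IH.
      assert (Hk := Hadd x y (a0 / 2 ^ k) (b0 / 2 ^ k) (pos _ _ Ha) (pos _ _ Hb)).
      unfold next. repeat destruct (excluded_middle_informative _); simpl; tauto. }
  assert (Hstep : forall k,
    (fst (s k) <= fst (s (S k)) /\
     fst (s (S k)) + a0 / 2 ^ S k <= fst (s k) + a0 / 2 ^ k) /\
    (snd (s k) <= snd (s (S k)) /\
     snd (s (S k)) + b0 / 2 ^ S k <= snd (s k) + b0 / 2 ^ k)).
  { intros k. rewrite <- !half. simpl. destruct (s k) as [x y]. simpl.
    assert (Pa := pos _ k Ha). assert (Pb := pos _ k Hb).
    unfold next. repeat destruct (excluded_middle_informative _); simpl; lra. }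
  destruct (nested_point (fun k => fst (s k)) (fun k => a0 / 2 ^ k)) as (p & Hp).
  { intros k. apply Hstep. } { intros k. left. now apply pos. }
  destruct (nested_point (fun k => snd (s k)) (fun k => b0 / 2 ^ k)) as (q & Hq).
  { intros k. apply Hstep. } { intros k. left. now apply pos. }
  destruct (Hloc p q) as (del & D & H).
  destruct (pow_lt_1_zero (/ 2)) with (y := del / (a0 + b0)) as (N & HN).
  { rewrite Rabs_pos_eq; lra. }
  { apply Rdiv_lt_0_compat; lra. }
  specialize (HN N (Nat.le_refl N)).
  rewrite Rabs_pos_eq in HN by (apply pow_le; lra). rewrite pow_inv in HN.
  assert (Hsum : a0 / 2 ^ N + b0 / 2 ^ N < del).
  { replace del with ((a0 + b0) * (del / (a0 + b0))) by (field; lra).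
    replace (a0 / 2 ^ N + b0 / 2 ^ N) with ((a0 + b0) * / 2 ^ N)
      by (field; generalize (pow2 N); lra).
    apply Rmult_lt_compat_l; lra. }
  apply (Hs N). assert (Pa := pos _ N Ha). assert (Pb := pos _ N Hb).
  apply H; auto; lra.
Qed.

Definition closed_in_C (K : C -> Prop) : Prop :=
  forall z, ~ K z -> exists d, 0 < d /\ forall w, Cmod (w - z) < d -> ~ K w.

Definition real_cont (g : C -> R) (z : C) : Prop :=
  forall eps, 0 < eps -> exists del, 0 < del /\
    forall w, Cmod (w - z) < del -> Rabs (g w - g z) < eps.

Lemma real_cont_Cmod (F : C -> C) (z : C) : cont F z -> real_cont (fun w => Cmod (F w)) z.
Proof.
  intros H e He. destruct (H e He) as (d & D & H'). exists d. split; [exact D|].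
  intros w Hw. apply Rle_lt_trans with (2 := H' w Hw).
  apply Rabs_le. generalize (Cmod_le_minus (F w) (F z)) (Cmod_le_minus (F z) (F w)).
  rewrite (Cmod_minus_sym (F z)). lra.
Qed.

Lemma real_cont_Re (F : C -> C) (z : C) : cont F z -> real_cont (fun w => Re (F w)) z.
Proof.
  intros H e He. destruct (H e He) as (d & D & H'). exists d. split; [exact D|].
  intros w Hw. apply Rle_lt_trans with (2 := H' w Hw).
  rewrite <- Re_minus. apply re_le_Cmod.
Qed.

Lemma real_cont_Im (F : C -> C) (z : C) : cont F z -> real_cont (fun w => Im (F w)) z.
Proof.
  intros H e He. destruct (H e He) as (d & D & H'). exists d. split; [exact D|].
  intros w Hw. apply Rle_lt_trans with (2 := H' w Hw).
  rewrite <- Im_minus. apply im_le_Cmod.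
Qed.

Lemma closed_and (K L : C -> Prop) :
  closed_in_C K -> closed_in_C L -> closed_in_C (fun z => K z /\ L z).
Proof.
  intros HK HL z Hz. destruct (classic (K z)) as [H|H].
  - destruct (HL z) as (d & D & Hd); [tauto|]. exists d. split; [exact D|].
    intros w Hw. specialize (Hd w Hw). tauto.
  - destruct (HK z H) as (d & D & Hd). exists d. split; [exact D|].
    intros w Hw. specialize (Hd w Hw). tauto.
Qed.

Lemma closed_ge (K : C -> Prop) (g : C -> R) (m : R) :
  closed_in_C K -> (forall z, K z -> real_cont g z) ->
  closed_in_C (fun z => K z /\ m <= g z).
Proof.
  intros HK Hg z Hz. destruct (classic (K z)) as [H|H].
  - destruct (Hg z H (m - g z)) as (d & D & Hd).
    { apply Rlt_0_minus. apply Rnot_le_lt. tauto. }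
    exists d. split; [exact D|].
    intros w Hw [_ Hm]. specialize (Hd w Hw). apply Rabs_def2 in Hd. lra.
  - destruct (HK z H) as (d & D & Hd). exists d. split; [exact D|].
    intros w Hw [Kw _]. now apply (Hd w Hw).
Qed.

Lemma Cmod_pair_lt (x y : R) (z : C) (d : R) :
  Rabs (x - Re z) < d / 2 -> Rabs (y - Im z) < d / 2 -> Cmod ((x, y) - z) < d.
Proof.
  intros H1 H2. apply Rle_lt_trans with (1 := Cmod_le_ReIm _).
  rewrite Re_minus, Im_minus. simpl. lra.
Qed.

Lemma extreme_value (K : C -> Prop) (g : C -> R) (B : R) :
  closed_in_C K -> (forall z, K z -> Cmod z <= B) -> (exists z, K z) ->
  (forall z, K z -> real_cont g z) ->
  exists z, K z /\ forall w, K w -> g w <= g z.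
Proof.
  intros HK HB (k0 & Hk0) Hg. apply NNPP. intros Hno.
  assert (B0 : 0 <= B) by (apply Rle_trans with (1 := Cmod_ge_0 k0); auto).
  assert (HP : exists z, K z /\ forall w, K w ->
    -(B+1) <= Re w <= -(B+1) + 2*(B+1) -> -(B+1) <= Im w <= -(B+1) + 2*(B+1) -> g w < g z).
  { apply (bisection (fun x y a b => exists z, K z /\ forall w, K w ->
      x <= Re w <= x + a -> y <= Im w <= y + b -> g w < g z)); [lra|lra| |].
    - intros x y a b Ha Hb (z1 & K1 & H1) (z2 & K2 & H2) (z3 & K3 & H3) (z4 & K4 & H4).
      assert (HM : exists z, K z /\ g z1 <= g z /\ g z2 <= g z /\ g z3 <= g z /\ g z4 <= g z).
      { assert (max2 : forall u v, K u -> K v -> exists z, K z /\ g u <= g z /\ g v <= g z).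
        { intros u v Ku Kv. destruct (Rle_lt_dec (g u) (g v)).
          - exists v. split; [exact Kv|]. split; [assumption|apply Rle_refl].
          - exists u. split; [exact Ku|]. split; [apply Rle_refl|now left]. }
        destruct (max2 z1 z2 K1 K2) as (u & Ku & ?). destruct (max2 z3 z4 K3 K4) as (v & Kv & ?).
        destruct (max2 u v Ku Kv) as (z & Kz & ?). exists z. split; [exact Kz|lra]. }
      destruct HM as (z & Kz & Hz). exists z. split; [exact Kz|]. intros w Kw Hx Hy.
      specialize (H1 w Kw). specialize (H2 w Kw). specialize (H3 w Kw). specialize (H4 w Kw).
      destruct (Rle_lt_dec (Re w) (x + a/2)), (Rle_lt_dec (Im w) (y + b/2)).
      + assert (g w < g z1) by (apply H1; lra). lra.
      + assert (g w < g z3) by (apply H3; lra). lra.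
      + assert (g w < g z2) by (apply H2; lra). lra.
      + assert (g w < g z4) by (apply H4; lra). lra.
    - intros p q. set (z := (p, q) : C).
      assert (HL : exists d, 0 < d /\ exists z', K z' /\
        forall w, Cmod (w - z) < d -> K w -> g w < g z').
      { destruct (classic (K z)) as [Kz|Kz].
        - assert (Hz : exists z', K z' /\ g z < g z').
          { apply NNPP. intros Hn. apply Hno. exists z. split; [exact Kz|].
            intros w Kw. apply Rnot_lt_le. intros Hlt. apply Hn. now exists w. }
          destruct Hz as (z' & Kz' & Hz').
          destruct (Hg z Kz (g z' - g z)) as (d & D & Hd); [lra|].
          exists d. split; [exact D|]. exists z'. split; [exact Kz'|].
          intros w Hw _. specialize (Hd w Hw). apply Rabs_def2 in Hd. lra.
        - destruct (HK z Kz) as (d & D & Hd). exists d. split; [exact D|].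
          exists k0. split; [exact Hk0|]. intros w Hw Kw. now destruct (Hd w Hw). }
      destruct HL as (d & D & z' & Kz' & Hd).
      exists (d / 2). split; [lra|]. intros x y k Hx Hy Hak Hbk.
      exists z'. split; [exact Kz'|]. intros w Kw Hxw Hyw. apply Hd; [|exact Kw].
      destruct w as [wx wy]. simpl in *.
      apply Cmod_pair_lt; simpl; apply Rabs_def1; lra. }
  destruct HP as (z & Kz & Hz).
  apply (Rlt_irrefl (g z)). apply Hz; [exact Kz| |];
    generalize (re_le_Cmod z) (im_le_Cmod z) (HB z Kz); intros H1 H2 H3;
    [apply Rle_trans with (2 := H3) in H1; apply Rabs_le_between in H1
    |apply Rle_trans with (2 := H3) in H2; apply Rabs_le_between in H2]; lra.
Qed.

(** * The complex exponential *)

Lemma cexp_plus (z w : C) : cexp (z + w) = (cexp z * cexp w)%C.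
Proof.
  unfold cexp, Cmult, Cplus; destruct z, w; simpl.
  rewrite exp_plus, cos_plus, sin_plus. f_equal; ring.
Qed.

Lemma Cmod_cexp (z : C) : Cmod (cexp z) = exp (Re z).
Proof.
  unfold Cmod, cexp; simpl fst; simpl snd.
  replace ((exp (Re z) * cos (Im z)) ^ 2 + (exp (Re z) * sin (Im z)) ^ 2)
    with ((exp (Re z)) ^ 2).
  - apply sqrt_pow2. left. apply exp_pos.
  - generalize (sin2_cos2 (Im z)). unfold Rsqr. intros H.
    transitivity (exp (Re z) ^ 2 * (sin (Im z) * sin (Im z) + cos (Im z) * cos (Im z))).
    + rewrite H. ring.
    + ring.
Qed.

Lemma cexp_0 : cexp 0 = 1%C.
Proof. unfold cexp; simpl. rewrite exp_0, cos_0, sin_0. unfold RtoC. f_equal; ring. Qed.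

Lemma first_order_at_0 (g : R -> R) (l : R) :
  derivable_pt_lim g 0 l -> forall eps, 0 < eps ->
  exists del, 0 < del /\ forall h, Rabs h < del -> Rabs (g h - g 0 - l * h) <= eps * Rabs h.
Proof.
  intros H e He. destruct (H e He) as (d & Hd). exists d. split; [apply cond_pos|].
  intros h Hh. destruct (Req_dec h 0) as [->|Hne].
  - replace (g 0 - g 0 - l * 0) with 0 by ring. rewrite Rabs_R0. lra.
  - specialize (Hd h Hne Hh). rewrite Rplus_0_l in Hd.
    replace (g h - g 0 - l * h) with (((g h - g 0) / h - l) * h) by (field; exact Hne).
    rewrite Rabs_mult. apply Rmult_le_compat_r; [apply Rabs_pos|lra].
Qed.

Lemma cexp_slope_0 : exists q, slope cexp q 0 /\ q 0%C = 1%C.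
Proof.
  apply slope_of_derivative. intros e0 He0.
  (* The four remainders below are at most 1, 3, 3 and 1 times [e * m], which explains the 8; the
     last one is quadratic in [m] and uses [m < e / 2]. *)
  set (e := Rmin 1 (e0 / 8)).
  assert (He : 0 < e) by (apply Rmin_glb_lt; lra).
  assert (He1 : e <= 1) by apply Rmin_l.
  assert (He8 : e <= e0 / 8) by apply Rmin_r.
  assert (D1 := derivable_pt_lim_exp 0). rewrite exp_0 in D1.
  assert (D2 := derivable_pt_lim_cos 0). rewrite sin_0, Ropp_0 in D2.
  assert (D3 := derivable_pt_lim_sin 0). rewrite cos_0 in D3.
  destruct (first_order_at_0 _ _ D1 e He) as (d1 & P1 & H1).
  destruct (first_order_at_0 _ _ D2 e He) as (d2 & P2 & H2).
  destruct (first_order_at_0 _ _ D3 e He) as (d3 & P3 & H3).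
  rewrite exp_0 in H1. rewrite cos_0 in H2. rewrite sin_0 in H3.
  set (d := Rmin (Rmin d1 d2) (Rmin d3 (e / 2))).
  assert (Hd : 0 < d /\ d <= d1 /\ d <= d2 /\ d <= d3 /\ d <= e / 2).
  { unfold d. repeat split.
    - repeat apply Rmin_glb_lt; lra.
    - eapply Rle_trans; [apply Rmin_l|apply Rmin_l].
    - eapply Rle_trans; [apply Rmin_l|apply Rmin_r].
    - eapply Rle_trans; [apply Rmin_r|apply Rmin_l].
    - eapply Rle_trans; [apply Rmin_r|apply Rmin_r]. }
  exists d. split; [apply Hd|]. intros w.
  rewrite cexp_0. replace (w - 0)%C with w by ring. intros Hw.
  replace (w * 1)%C with w by ring.
  destruct w as [x y].
  assert (Hx : Rabs x <= Cmod (x, y)) by exact (re_le_Cmod (x, y)).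
  assert (Hy : Rabs y <= Cmod (x, y)) by exact (im_le_Cmod (x, y)).
  set (m := Cmod (x, y)) in *. assert (Hm : 0 <= m) by apply Cmod_ge_0.
  assert (K1 := H1 x ltac:(lra)). assert (K2 := H2 y ltac:(lra)).
  assert (K3 := H3 y ltac:(lra)).
  apply Rle_trans with (1 := Cmod_le_ReIm _).
  unfold cexp. rewrite !Re_minus, !Im_minus. simpl.
  replace (exp x * cos y - 1 - x) with ((exp x - 1 - 1 * x) + exp x * (cos y - 1 - 0 * y)) by ring.
  replace (exp x * sin y - 0 - y)
    with (exp x * (sin y - 0 - 1 * y) + y * ((exp x - 1 - 1 * x) + x)) by ring.
  assert (Bx : Rabs (exp x - 1 - 1 * x) <= e * m).
  { apply Rle_trans with (1 := K1). apply Rmult_le_compat_l; lra. }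
  assert (Bc : Rabs (cos y - 1 - 0 * y) <= e * m).
  { apply Rle_trans with (1 := K2). apply Rmult_le_compat_l; lra. }
  assert (Bs : Rabs (sin y - 0 - 1 * y) <= e * m).
  { apply Rle_trans with (1 := K3). apply Rmult_le_compat_l; lra. }
  assert (em : e * m <= 1 / 2) by nra.
  assert (Bt : Rabs ((exp x - 1 - 1 * x) + x) <= 2 * m).
  { apply Rle_trans with (1 := Rabs_triang _ _). nra. }
  assert (Be : 0 < exp x <= 3).
  { split; [apply exp_pos|]. generalize (Rle_abs (exp x - 1 - 1 * x)) (Rle_abs x). lra. }
  assert (T1 : Rabs (exp x * (cos y - 1 - 0 * y)) <= 3 * (e * m)).
  { rewrite Rabs_mult, (Rabs_pos_eq (exp x)) by lra.
    apply Rmult_le_compat; try lra. apply Rabs_pos. }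
  assert (T2 : Rabs (exp x * (sin y - 0 - 1 * y)) <= 3 * (e * m)).
  { rewrite Rabs_mult, (Rabs_pos_eq (exp x)) by lra.
    apply Rmult_le_compat; try lra. apply Rabs_pos. }
  assert (T3 : Rabs (y * ((exp x - 1 - 1 * x) + x)) <= m * (2 * m)).
  { rewrite Rabs_mult. apply Rmult_le_compat; auto using Rabs_pos. }
  assert (m * (2 * m) <= e * m) by nra.
  assert (e * m <= e0 / 8 * m) by (apply Rmult_le_compat_r; lra).
  eapply Rle_trans; [apply Rplus_le_compat; apply Rabs_triang|]. lra.
Qed.

Lemma cexp_slope (z : C) : exists q, slope cexp q z /\ q z = cexp z.
Proof.
  destruct cexp_slope_0 as (q & (Hc & Hq) & H1).
  exists (fun w => cexp z * q (w + (- z)))%C. split; [split|].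
  - apply cont_mult; [apply cont_const|]. apply cont_comp with (F := q).
    + apply cont_plus; [apply cont_id|apply cont_const].
    + replace (z + - z)%C with (RtoC 0) by ring. exact Hc.
  - intros w. replace w with (z + (w + - z))%C at 1 by ring. rewrite cexp_plus.
    assert (E := Hq (w + - z)%C). rewrite cexp_0 in E.
    replace (cexp z * cexp (w + - z) - cexp z)%C
      with (cexp z * (cexp (w + - z) - 1))%C by ring.
    rewrite E. ring.
  - replace (z + - z)%C with (RtoC 0) by ring. rewrite H1. ring.
Qed.

Lemma cdiff_cexp (z : C) : cdiff cexp z.
Proof. destruct (cexp_slope z) as (q & H & _). now exists q. Qed.

(** * Goursat's theorem for rectangles and the mean value property *)

Lemma continuous_line (p : R -> C) (g : C -> R) (t : R) :
  real_cont g (p t) -> (forall s, Cmod (p s - p t) <= Rabs (s - t)) ->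
  continuous (fun s => g (p s)) t.
Proof.
  intros Hg Hp P (e & HP). destruct (Hg e (cond_pos e)) as (d & D & H).
  exists (mkposreal d D). intros s Hs. apply HP. apply H.
  apply Rle_lt_trans with (1 := Hp s). exact Hs.
Qed.

Lemma Cmod_vertical (x s t : R) : Cmod ((x, s) - (x, t)) <= Rabs (s - t).
Proof.
  apply Rle_trans with (1 := Cmod_le_ReIm _). rewrite Re_minus, Im_minus. simpl.
  rewrite Rminus_diag, Rabs_R0. lra.
Qed.

Lemma Cmod_horizontal (y s t : R) : Cmod ((s, y) - (t, y)) <= Rabs (s - t).
Proof.
  apply Rle_trans with (1 := Cmod_le_ReIm _). rewrite Re_minus, Im_minus. simpl.
  rewrite Rminus_diag, Rabs_R0. lra.
Qed.

Lemma continuous_vertical (G : C -> C) (x t : R) :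
  cont G (x, t) -> continuous (fun s => Re (G (x, s))) t.
Proof.
  intros H. apply (continuous_line (fun s => (x, s) : C) (fun z => Re (G z))).
  - now apply real_cont_Re.
  - intros s. apply Cmod_vertical.
Qed.

Lemma continuous_horizontal (G : C -> C) (y t : R) :
  cont G (t, y) -> continuous (fun s => Im (G (s, y))) t.
Proof.
  intros H. apply (continuous_line (fun s => (s, y) : C) (fun z => Im (G z))).
  - now apply real_cont_Im.
  - intros s. apply Cmod_horizontal.
Qed.

Section Goursat.
Variables (G : C -> C) (x0 y0 a0 b0 : R).
Hypothesis a0_pos : 0 < a0.
Hypothesis b0_pos : 0 < b0.
Hypothesis G_diff : forall x y, x0 <= x <= x0 + a0 -> y0 <= y <= y0 + b0 -> cdiff G (x, y).

(* The imaginary part of the integral of [G] along the boundary of the rectangle. *)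
Let J x y a b :=
  RInt (fun t => Re (G (x + a, t)) - Re (G (x, t))) y (y + b) +
  RInt (fun t => Im (G (t, y)) - Im (G (t, y + b))) x (x + a).

Let inside x y a b := x0 <= x /\ x + a <= x0 + a0 /\ y0 <= y /\ y + b <= y0 + b0.

Lemma vertical_integrable (x x' y y' : R) :
  x0 <= x <= x0 + a0 -> x0 <= x' <= x0 + a0 -> y0 <= y -> y <= y' -> y' <= y0 + b0 ->
  ex_RInt (fun t => Re (G (x', t)) - Re (G (x, t))) y y'.
Proof.
  intros Hx Hx' H1 H2 H3. apply (ex_RInt_continuous (V := R_CompleteNormedModule)).
  intros t. rewrite Rmin_left, Rmax_right by lra. intros Ht.
  apply (continuous_minus (fun t => Re (G (x', t))));
    apply continuous_vertical, cdiff_cont, G_diff; lra.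
Qed.

Lemma horizontal_integrable (x x' y y' : R) :
  y0 <= y <= y0 + b0 -> y0 <= y' <= y0 + b0 -> x0 <= x -> x <= x' -> x' <= x0 + a0 ->
  ex_RInt (fun t => Im (G (t, y)) - Im (G (t, y'))) x x'.
Proof.
  intros Hx Hx' H1 H2 H3. apply (ex_RInt_continuous (V := R_CompleteNormedModule)).
  intros t. rewrite Rmin_left, Rmax_right by lra. intros Ht.
  apply (continuous_minus (fun t => Im (G (t, y))));
    apply continuous_horizontal, cdiff_cont, G_diff; lra.
Qed.

Lemma vertical_split (x x' x'' y y' y'' : R) :
  x0 <= x -> x <= x' -> x' <= x'' -> x'' <= x0 + a0 ->
  y0 <= y -> y <= y' -> y' <= y'' -> y'' <= y0 + b0 ->
  RInt (fun t => Re (G (x'', t)) - Re (G (x, t))) y y'' =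
  RInt (fun t => Re (G (x', t)) - Re (G (x, t))) y y' +
  RInt (fun t => Re (G (x'', t)) - Re (G (x', t))) y y' +
  RInt (fun t => Re (G (x', t)) - Re (G (x, t))) y' y'' +
  RInt (fun t => Re (G (x'', t)) - Re (G (x', t))) y' y''.
Proof.
  intros.
  assert (S : forall u v, y0 <= u -> u <= v -> v <= y0 + b0 ->
    RInt (fun t => Re (G (x'', t)) - Re (G (x, t))) u v =
    RInt (fun t => Re (G (x', t)) - Re (G (x, t))) u v +
    RInt (fun t => Re (G (x'', t)) - Re (G (x', t))) u v).
  { intros u v Hu Huv Hv.
    rewrite <- (RInt_plus (V := R_CompleteNormedModule)) by (apply vertical_integrable; lra).
    apply RInt_ext. intros t _. unfold plus; simpl. ring. }
  rewrite <- (RInt_Chasles (V := R_CompleteNormedModule) _ y y' y'')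
    by (apply vertical_integrable; lra).
  rewrite !S by lra. unfold plus; simpl. ring.
Qed.

Lemma horizontal_split (x x' x'' y y' y'' : R) :
  x0 <= x -> x <= x' -> x' <= x'' -> x'' <= x0 + a0 ->
  y0 <= y -> y <= y' -> y' <= y'' -> y'' <= y0 + b0 ->
  RInt (fun t => Im (G (t, y)) - Im (G (t, y''))) x x'' =
  RInt (fun t => Im (G (t, y)) - Im (G (t, y'))) x x' +
  RInt (fun t => Im (G (t, y)) - Im (G (t, y'))) x' x'' +
  RInt (fun t => Im (G (t, y')) - Im (G (t, y''))) x x' +
  RInt (fun t => Im (G (t, y')) - Im (G (t, y''))) x' x''.
Proof.
  intros.
  assert (S : forall u v, x0 <= u -> u <= v -> v <= x0 + a0 ->
    RInt (fun t => Im (G (t, y)) - Im (G (t, y''))) u v =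
    RInt (fun t => Im (G (t, y)) - Im (G (t, y'))) u v +
    RInt (fun t => Im (G (t, y')) - Im (G (t, y''))) u v).
  { intros u v Hu Huv Hv.
    rewrite <- (RInt_plus (V := R_CompleteNormedModule)) by (apply horizontal_integrable; lra).
    apply RInt_ext. intros t _. unfold plus; simpl. ring. }
  rewrite <- (RInt_Chasles (V := R_CompleteNormedModule) _ x x' x'')
    by (apply horizontal_integrable; lra).
  rewrite !S by lra. unfold plus; simpl. ring.
Qed.

Lemma RInt_near_const (g : R -> R) (u v k e : R) :
  u <= v -> ex_RInt g u v -> (forall t, u <= t <= v -> Rabs (g t - k) <= e) ->
  Rabs (RInt g u v - k * (v - u)) <= (v - u) * e.
Proof.
  intros Huv Hg H.
  assert (Hc : ex_RInt (fun _ : R => k) u v) by apply ex_RInt_const.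
  replace (RInt g u v - k * (v - u)) with (RInt (fun t => g t - k) u v).
  - apply abs_RInt_le_const; auto. now apply (ex_RInt_minus g).
  - rewrite (RInt_minus (V := R_CompleteNormedModule) g (fun _ => k)) by auto.
    rewrite RInt_const. unfold minus, plus, opp, scal; simpl. unfold mult; simpl. ring.
Qed.

(** The tangent affine map contributes [Re l * a * b] through the vertical sides and the opposite
    through the horizontal ones. Only the remainder, at most [eta * (a + b)] on each side,
    survives. *)
Lemma goursat_local (p q eta : R) : 0 < eta -> x0 <= p <= x0 + a0 -> y0 <= q <= y0 + b0 ->
  exists del, 0 < del /\ forall x y a b, inside x y a b -> 0 < a -> 0 < b ->
    x <= p <= x + a -> y <= q <= y + b -> a < del -> b < del ->
    Rabs (J x y a b) <= 2 * eta * (a + b) ^ 2.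
Proof.
  intros He Hp Hq. destruct (G_diff p q Hp Hq) as (s & Hs & E).
  destruct (Hs eta He) as (d & D & Hd).
  exists (d / 2). split; [lra|]. intros x y a b (I1 & I2 & I3 & I4) Ha Hb Hx Hy Had Hbd.
  set (z := (p, q) : C) in *. set (l := s z) in *.
  assert (K : forall u v, x <= u <= x + a -> y <= v <= y + b ->
    Cmod (G (u, v) - G z - l * ((u, v) - z)) <= eta * (a + b)).
  { intros u v Hu Hv.
    assert (L : Cmod ((u, v) - z) <= a + b).
    { apply Rle_trans with (1 := Cmod_le_ReIm _). rewrite Re_minus, Im_minus. unfold z; simpl.
      apply Rplus_le_compat; apply Rabs_le; lra. }
    rewrite E. replace (s (u, v) * ((u, v) - z) - l * ((u, v) - z))%C
      with ((s (u, v) - l) * ((u, v) - z))%C by ring.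
    rewrite Cmod_mult. apply Rmult_le_compat; auto using Cmod_ge_0.
    left. apply Hd. lra. }
  assert (KR : forall u v, x <= u <= x + a -> y <= v <= y + b ->
    Rabs (Re (G (u, v)) - Re (G z) - (Re l * (u - p) - Im l * (v - q))) <= eta * (a + b)).
  { intros u v Hu Hv. apply Rle_trans with (2 := K u v Hu Hv).
    apply Rle_trans with (2 := re_le_Cmod _). right.
    rewrite !Re_minus, Re_mult, Re_minus, Im_minus. reflexivity. }
  assert (KI : forall u v, x <= u <= x + a -> y <= v <= y + b ->
    Rabs (Im (G (u, v)) - Im (G z) - (Re l * (v - q) + Im l * (u - p))) <= eta * (a + b)).
  { intros u v Hu Hv. apply Rle_trans with (2 := K u v Hu Hv).
    apply Rle_trans with (2 := im_le_Cmod _). right.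
    rewrite !Im_minus, Im_mult, Re_minus, Im_minus. reflexivity. }
  unfold J.
  assert (V := RInt_near_const (fun t => Re (G (x + a, t)) - Re (G (x, t))) y (y + b)
    (Re l * a) (2 * eta * (a + b)) ltac:(lra)
    ltac:(apply vertical_integrable; lra)).
  assert (H := RInt_near_const (fun t => Im (G (t, y)) - Im (G (t, y + b))) x (x + a)
    (- Re l * b) (2 * eta * (a + b)) ltac:(lra)
    ltac:(apply horizontal_integrable; lra)).
  assert (V' := V ltac:(intros t Ht; generalize (KR (x + a) t ltac:(lra) Ht) (KR x t ltac:(lra) Ht);
    intros A1 A2; apply Rabs_le_between in A1, A2; apply Rabs_le; lra)).
  assert (H' := H ltac:(intros t Ht; generalize (KI t y Ht ltac:(lra)) (KI t (y + b) Ht ltac:(lra));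
    intros A1 A2; apply Rabs_le_between in A1, A2; apply Rabs_le; lra)).
  apply Rabs_le_between in V', H'. apply Rabs_le. lra.
Qed.

(** [J] is additive over quarters, so a local bound by a small multiple of [a ^ 2] propagates to the
    whole rectangle. The imaginary part is enough, because only mean values of real parts are used
    later. *)
Lemma goursat :
  RInt (fun t => Re (G (x0 + a0, t)) - Re (G (x0, t))) y0 (y0 + b0) +
  RInt (fun t => Im (G (t, y0)) - Im (G (t, y0 + b0))) x0 (x0 + a0) = 0.
Proof.
  change (J x0 y0 a0 b0 = 0).
  (* Bisection keeps the ratio of the sides, so [2 * (a + b) ^ 2 = c * a ^ 2] for every rectangle
     that occurs. *)
  set (c := 2 * (1 + b0 / a0) ^ 2).
  assert (Hr : 0 < b0 / a0) by now apply Rdiv_lt_0_compat.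
  assert (Hc : 0 < c) by (unfold c; nra).
  assert (key : forall eps, 0 < eps -> Rabs (J x0 y0 a0 b0) <= eps * a0 ^ 2).
  { intros eps He.
    apply (bisection (fun x y a b => inside x y a b -> Rabs (J x y a b) <= eps * a ^ 2) x0 y0 a0 b0);
      auto; [| |unfold inside; lra].
    - intros x y a b Ha Hb H1 H2 H3 H4 (I1 & I2 & I3 & I4).
      assert (E : J x y a b = J x y (a/2) (b/2) + J (x + a/2) y (a/2) (b/2) +
        J x (y + b/2) (a/2) (b/2) + J (x + a/2) (y + b/2) (a/2) (b/2)).
      { unfold J. rewrite (vertical_split x (x + a/2) (x + a) y (y + b/2) (y + b)) by lra.
        rewrite (horizontal_split x (x + a/2) (x + a) y (y + b/2) (y + b)) by lra.
        replace (x + a/2 + a/2) with (x + a) by field.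
        replace (y + b/2 + b/2) with (y + b) by field. ring. }
      rewrite E. unfold inside in *.
      assert (B1 := H1 ltac:(lra)). assert (B2 := H2 ltac:(lra)).
      assert (B3 := H3 ltac:(lra)). assert (B4 := H4 ltac:(lra)).
      apply Rabs_le_between in B1, B2, B3, B4. apply Rabs_le. lra.
    - intros p q.
      destruct (classic (x0 <= p <= x0 + a0 /\ y0 <= q <= y0 + b0)) as [[Hp Hq]|Hout].
      + destruct (goursat_local p q (eps / c)) as (d & D & H); auto.
        { now apply Rdiv_lt_0_compat. }
        exists d. split; [exact D|]. intros x y k Hx Hy Hak Hbk I.
        assert (P2 : 0 < 2 ^ k) by (apply pow_lt; lra).
        apply Rle_trans with (1 := H x y _ _ I (Rdiv_lt_0_compat _ _ a0_pos P2)
          (Rdiv_lt_0_compat _ _ b0_pos P2) Hx Hy Hak Hbk).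
        right. unfold c. field. repeat split; try lra.
      + exists 1. split; [lra|]. intros x y k Hx Hy _ _ (I1 & I2 & I3 & I4).
        exfalso. apply Hout. lra. }
  destruct (Req_dec (J x0 y0 a0 b0) 0) as [E|E]; [exact E|exfalso].
  assert (HJ := Rabs_pos_lt _ E).
  assert (Ha2 : 0 < a0 ^ 2) by now apply pow_lt.
  assert (HE : 0 < Rabs (J x0 y0 a0 b0) / (2 * a0 ^ 2)) by (apply Rdiv_lt_0_compat; lra).
  assert (K := key _ HE).
  replace (Rabs (J x0 y0 a0 b0) / (2 * a0 ^ 2) * a0 ^ 2) with (Rabs (J x0 y0 a0 b0) / 2) in K
    by (field; lra).
  lra.
Qed.
End Goursat.

(* In the coordinates [w = z + exp (x + i t)] the circles around [z] become the vertical sides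
   of a rectangle, whose horizontal sides cancel by periodicity; so the integral over a circle
   does not depend on the radius, and [F] need not be differentiable at [z] itself. *)
Lemma mean_value (F : C -> C) (z : C) (rho : R) :
  0 < rho -> cont F z ->
  (forall w, w <> z -> Cmod (w - z) <= rho -> cdiff F w) ->
  RInt (fun t => Re (F (z + cexp (ln rho, t))%C)) 0 (2 * PI) = 2 * PI * Re (F z).
Proof.
  intros Hrho HF Hd. assert (HPI := PI_RGT_0).
  set (G := fun w => F (z + cexp w)%C).
  assert (Gd : forall x y, x <= ln rho -> cdiff G (x, y)).
  { intros x y Hx. unfold G. apply cdiff_comp.
    - apply cdiff_plus; [apply cdiff_const|apply cdiff_cexp].
    - apply Hd.
      + intros E. assert (K : cexp (x, y) = 0%C).
        { replace (cexp (x, y)) with ((z + cexp (x, y)) - z)%C by ring. rewrite E. ring. }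
        assert (M := Cmod_cexp (x, y)). rewrite K, Cmod_0 in M.
        generalize (exp_pos (Re (x, y))). lra.
      + replace (z + cexp (x, y) - z)%C with (cexp (x, y)) by ring.
        rewrite Cmod_cexp. simpl. rewrite <- (exp_ln rho) by exact Hrho.
        destruct Hx as [Hx| ->]; [left; now apply exp_increasing|right; reflexivity]. }
  assert (int : forall x, x <= ln rho -> ex_RInt (fun t => Re (G (x, t))) 0 (2 * PI)).
  { intros x Hx. apply (ex_RInt_continuous (V := R_CompleteNormedModule)). intros t _.
    apply continuous_vertical, cdiff_cont, Gd, Hx. }
  assert (close : forall eps, 0 < eps ->
    Rabs (RInt (fun t => Re (G (ln rho, t))) 0 (2 * PI) - Re (F z) * (2 * PI - 0))
      <= (2 * PI - 0) * eps).
  { intros e He. destruct (HF e He) as (d & D & Hcl).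
    (* The first bound gives the rectangle positive width, the second puts the inner circle where
       [F] is within [e] of [F z]. *)
    set (m := Rmin (rho / 2) (d / 2)).
    assert (Hm : 0 < m /\ m <= rho / 2 /\ m <= d / 2).
    { unfold m. repeat split; [apply Rmin_glb_lt; lra|apply Rmin_l|apply Rmin_r]. }
    assert (Hln : ln m < ln rho) by (apply ln_increasing; lra).
    assert (J := goursat G (ln m) 0 (ln rho - ln m) (2 * PI) ltac:(lra) ltac:(lra)
      ltac:(intros x y Hx _; apply Gd; lra)).
    replace (ln m + (ln rho - ln m)) with (ln rho) in J by ring. rewrite Rplus_0_l in J.
    rewrite (RInt_ext _ (fun _ => 0) (ln m)) in J.
    2:{ intros t _. unfold G, cexp; simpl. rewrite cos_2PI, sin_2PI, cos_0, sin_0. lra. }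
    rewrite RInt_const in J. unfold scal in J; simpl in J. unfold mult in J; simpl in J.
    rewrite Rmult_0_r, Rplus_0_r in J.
    rewrite (RInt_minus (V := R_CompleteNormedModule) (fun t => Re (G (ln rho, t)))) in J
      by (apply int; lra).
    unfold minus, plus, opp in J; simpl in J.
    replace (RInt (fun t => Re (G (ln rho, t))) 0 (2 * PI))
      with (RInt (fun t => Re (G (ln m, t))) 0 (2 * PI)) by lra.
    apply RInt_near_const; [lra|apply int; lra|]. intros t _.
    rewrite <- Re_minus. apply Rle_trans with (1 := re_le_Cmod _). left. apply Hcl.
    replace (z + cexp (ln m, t) - z)%C with (cexp (ln m, t)) by ring.
    rewrite Cmod_cexp. simpl. rewrite exp_ln; lra. }
  apply Rminus_diag_uniq. rewrite (Rmult_comm (2 * PI)).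
  apply NNPP. intros E. apply Rabs_pos_lt in E. rewrite Rminus_0_r in close.
  fold G in E.
  change (fun t => Re (F (z + cexp (ln rho, t))%C)) with (fun t => Re (G (ln rho, t))) in E.
  set (X := RInt _ _ _ - _) in *.
  assert (K := close (Rabs X / (4 * PI)) ltac:(apply Rdiv_lt_0_compat; lra)).
  replace (2 * PI * (Rabs X / (4 * PI))) with (Rabs X / 2) in K by (field; lra).
  lra.
Qed.

(** * The maximum principle *)

Lemma RInt_max_attained (g : R -> R) (a b m : R) :
  a < b -> (forall t, a <= t <= b -> continuous g t) -> (forall t, a <= t <= b -> g t <= m) ->
  RInt g a b = (b - a) * m -> g a = m.
Proof.
  intros Hab Hc Hle Heq. apply NNPP. intros Hne.
  assert (Hlt : g a < m) by (specialize (Hle a ltac:(lra)); lra).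
  destruct (Hc a ltac:(lra) (fun y => y < (g a + m) / 2)) as (d & Hd).
  { exists (mkposreal ((m - g a) / 2) ltac:(lra)). intros y Hy. apply Rabs_def2 in Hy.
    unfold minus, plus, opp in Hy; simpl in Hy. lra. }
  set (c := Rmin b (a + d / 2)).
  assert (Hd0 := cond_pos d).
  assert (Hac : a < c <= b).
  { split; [apply Rmin_glb_lt; lra|apply Rmin_l]. }
  assert (Hcd : c <= a + d / 2) by apply Rmin_r.
  assert (int : forall u v, a <= u -> u <= v -> v <= b -> ex_RInt g u v).
  { intros u v Hu Huv Hv. apply (ex_RInt_continuous (V := R_CompleteNormedModule)).
    intros t. rewrite Rmin_left, Rmax_right by lra. intros Ht. apply Hc. lra. }
  assert (I1 : RInt g a c <= (c - a) * ((g a + m) / 2)).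
  { replace ((c - a) * ((g a + m) / 2)) with (RInt (fun _ => (g a + m) / 2) a c)
      by (rewrite RInt_const; reflexivity).
    apply RInt_le; [lra|apply int; lra|apply ex_RInt_const|].
    intros t Ht. left. apply Hd. apply Rabs_def1; unfold minus, plus, opp; simpl; lra. }
  assert (I2 : RInt g c b <= (b - c) * m).
  { replace ((b - c) * m) with (RInt (fun _ => m) c b) by (rewrite RInt_const; reflexivity).
    apply RInt_le; [lra|apply int; lra|apply ex_RInt_const|].
    intros t Ht. apply Hle. lra. }
  assert (Ch := RInt_Chasles (V := R_CompleteNormedModule) g a c b
    (int a c ltac:(lra) ltac:(lra) ltac:(lra)) (int c b ltac:(lra) ltac:(lra) ltac:(lra))).
  unfold plus in Ch; simpl in Ch. nra.
Qed.

(** Differentiability at the centre is left out so that the maximum principle applies to difference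
    quotients, which are only known to be continuous there. *)
Definition interior_nice (F : C -> C) (K : C -> Prop) (z : C) : Prop :=
  exists rho, 0 < rho /\ forall w, Cmod (w - z) <= rho -> K w /\ (w <> z -> cdiff F w).

(** Among the points of [K] where the modulus is maximal, take one that lies farthest to the right.
    If it were interior, the mean value of [F], rotated to be real and positive at that point, would
    force the maximum at the rightmost point of a small circle too. This choice replaces a
    connectedness argument. *)
Lemma maximum_principle (F : C -> C) (K : C -> Prop) (A B : R) :
  closed_in_C K -> (forall z, K z -> Cmod z <= A) -> (forall z, K z -> cont F z) ->
  (forall z, K z -> Cmod (F z) <= B \/ interior_nice F K z) ->
  forall z, K z -> Cmod (F z) <= B.
Proof.
  intros HK HA Hc HB z Kz. apply Rnot_lt_le. intros Hz.
  destruct (extreme_value K (fun w => Cmod (F w)) A HK HA (ex_intro _ z Kz)) as (z1 & Kz1 & Hmax).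
  { intros w Kw. apply real_cont_Cmod; auto. }
  set (m := Cmod (F z1)) in *. assert (Hm : B < m) by (specialize (Hmax z Kz); lra).
  destruct (extreme_value (fun w => K w /\ m <= Cmod (F w)) (fun w => Re w) A)
    as (z2 & (Kz2 & Hz2) & Hre).
  { apply closed_ge; [exact HK|]. intros w Kw. apply real_cont_Cmod; auto. }
  { intros w (Kw & _). auto. }
  { exists z1. split; [exact Kz1|apply Rle_refl]. }
  { intros w _. apply (real_cont_Re (fun w => w)), cont_id. }
  destruct (HB z2 Kz2) as [Hb|(rho & Hrho & Hin)]; [lra|].
  assert (E2 : Cmod (F z2) = m) by (apply Rle_antisym; auto).
  assert (Hm0 : 0 <= m) by apply Cmod_ge_0.
  (* For [m = 0] the rotation [om] would divide by zero; but then every point of [K] is a maximum,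
     and a step to the right already contradicts the choice of [z2]. *)
  destruct (Req_dec m 0) as [m0|m0].
  { destruct (Hin (z2 + RtoC rho)%C) as (Kn & _).
    { replace (z2 + RtoC rho - z2)%C with (RtoC rho) by ring. rewrite Cmod_R, Rabs_pos_eq; lra. }
    assert (H := Hre (z2 + RtoC rho)%C (conj Kn (eq_ind_r (fun x => x <= _) (Cmod_ge_0 _) m0))).
    simpl in H. unfold Re in H. lra. }
  set (om := (Cconj (F z2) / RtoC m)%C).
  assert (Hm' : RtoC m <> 0%C) by (intros H; apply RtoC_inj in H; contradiction).
  assert (Hom : Cmod om = 1).
  { unfold om. rewrite Cmod_div, Cmod_conj, Cmod_R, Rabs_pos_eq, E2 by auto. field. exact m0. }
  set (H := fun w => (om * F w)%C).
  assert (HRe : Re (H z2) = m).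
  { unfold H, om.
    replace (Cconj (F z2) / RtoC m * F z2)%C with (F z2 * Cconj (F z2) / RtoC m)%C by (field; auto).
    rewrite <- Cmod2_conj, E2.
    replace (RtoC (m ^ 2) / RtoC m)%C with (RtoC m); [reflexivity|].
    simpl. rewrite Rmult_1_r, RtoC_mult. field. auto. }
  assert (Hle : forall w, K w -> Re (H w) <= m).
  { intros w Kw. apply Rle_trans with (1 := Rle_abs _).
    apply Rle_trans with (1 := re_le_Cmod _). unfold H. rewrite Cmod_mult, Hom, Rmult_1_l. auto. }
  assert (on_circle : forall t, Cmod (z2 + cexp (ln rho, t) - z2) <= rho).
  { intros t. replace (z2 + cexp (ln rho, t) - z2)%C with (cexp (ln rho, t)) by ring.
    rewrite Cmod_cexp. simpl. rewrite exp_ln; lra. }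
  assert (HPI := PI_RGT_0).
  assert (M := mean_value H z2 rho Hrho
    ltac:(apply cont_mult; [apply cont_const|auto])
    ltac:(intros w Hw Hwr; apply cdiff_mult; [apply cdiff_const|now apply Hin])).
  rewrite HRe in M.
  (* Angle 0 is an end point of the range of integration and gives the rightmost point of the
     circle, so equality is needed only there. *)
  assert (E0 : Re (H (z2 + cexp (ln rho, 0))%C) = m).
  { apply (RInt_max_attained (fun t => Re (H (z2 + cexp (ln rho, t))%C)) 0 (2 * PI)).
    - lra.
    - intros t _. apply (continuous_vertical (fun w => H (z2 + cexp w)%C)).
      apply (cont_comp H).
      + apply cdiff_cont, cdiff_plus; [apply cdiff_const|apply cdiff_cexp].
      + apply cont_mult; [apply cont_const|]. now apply Hc, Hin.
    - intros t _. apply Hle. now apply Hin.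
    - rewrite M. change (2 * PI * m = (2 * PI - 0) * m). ring. }
  destruct (Hin (z2 + cexp (ln rho, 0))%C (on_circle 0)) as (Kn & _).
  assert (Hn : m <= Cmod (F (z2 + cexp (ln rho, 0))%C)).
  { rewrite <- E0 at 1. apply Rle_trans with (1 := Rle_abs _).
    apply Rle_trans with (1 := re_le_Cmod _). unfold H. rewrite Cmod_mult, Hom. lra. }
  assert (L := Hre _ (conj Kn Hn)). unfold cexp in L; simpl in L. unfold Re in L; simpl in L.
  rewrite exp_ln, cos_0 in L by exact Hrho. lra.
Qed.

Lemma closed_real_ge (g : C -> R) (m : R) :
  (forall z, real_cont g z) -> closed_in_C (fun z => m <= g z).
Proof.
  intros Hg z Hz. apply Rnot_le_lt in Hz.
  destruct (Hg z (m - g z)) as (d & D & Hd); [lra|]. exists d. split; [exact D|].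
  intros w Hw K. specialize (Hd w Hw). apply Rabs_def2 in Hd. lra.
Qed.

Lemma closed_real_le (g : C -> R) (m : R) :
  (forall z, real_cont g z) -> closed_in_C (fun z => g z <= m).
Proof.
  intros Hg z Hz. apply Rnot_le_lt in Hz.
  destruct (Hg z (g z - m)) as (d & D & Hd); [lra|]. exists d. split; [exact D|].
  intros w Hw K. specialize (Hd w Hw). apply Rabs_def2 in Hd. lra.
Qed.

Lemma real_cont_dist (z w : C) : real_cont (fun u => Cmod (u - z)) w.
Proof.
  apply (real_cont_Cmod (fun u => u - z)%C). apply cont_plus; [apply cont_id|apply cont_const].
Qed.

Lemma real_cont_lt (g : C -> R) (z : C) (m : R) :
  real_cont g z -> g z < m ->
  exists rho, 0 < rho /\ forall w, Cmod (w - z) <= rho -> g w < m.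
Proof.
  intros Hg Hz. destruct (Hg (m - g z)) as (d & D & Hd); [lra|].
  exists (d / 2). split; [lra|]. intros w Hw.
  assert (K := Hd w ltac:(lra)). apply Rabs_def2 in K. lra.
Qed.

Lemma real_cont_gt (g : C -> R) (z : C) (m : R) :
  real_cont g z -> m < g z ->
  exists rho, 0 < rho /\ forall w, Cmod (w - z) <= rho -> m < g w.
Proof.
  intros Hg Hz. destruct (Hg (g z - m)) as (d & D & Hd); [lra|].
  exists (d / 2). split; [lra|]. intros w Hw.
  assert (K := Hd w ltac:(lra)). apply Rabs_def2 in K. lra.
Qed.

Lemma Cmod_le_dist (z w : C) (r : R) : Cmod (w - z) <= r -> Cmod w <= Cmod z + r.
Proof. intros H. generalize (Cmod_le_minus w z). lra. Qed.

Lemma cdiff_local (F G : C -> C) (z : C) :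
  (exists d, 0 < d /\ forall w, Cmod (w - z) < d -> F w = G w) -> cdiff F z -> cdiff G z.
Proof.
  intros (d & D & E) (q & Hq & H). apply slope_local with q; [exact Hq|].
  exists d. split; [exact D|]. intros w Hw. rewrite <- !E; auto.
  replace (z - z)%C with (RtoC 0) by ring. now rewrite Cmod_0.
Qed.

Lemma Cminus_neq0 (z w : C) : w <> z -> (w - z)%C <> 0%C.
Proof.
  intros H K. apply H. replace w with ((w - z) + z)%C by ring. rewrite K. ring.
Qed.

(** * Cauchy's estimates, three circles and iterated contraction *)

Lemma slope_cdiff (F q : C -> C) (z w : C) :
  (forall u, cdiff F u) -> slope F q z -> w <> z -> cdiff q w.
Proof.
  intros HF (_ & E) Hw. assert (Hne := Cminus_neq0 _ _ Hw).
  apply cdiff_local with (fun u => (F u + - F z) * / (u + - z))%C.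
  - exists (Cmod (w - z)). split; [now apply Cmod_gt_0|]. intros u Hu.
    assert (u <> z). { intros ->. rewrite Cmod_minus_sym in Hu. lra. }
    replace (F u + - F z)%C with (F u - F z)%C by ring. rewrite E.
    field. now apply Cminus_neq0.
  - apply cdiff_mult.
    + apply cdiff_plus; [apply HF|apply cdiff_const].
    + apply (cdiff_comp Cinv).
      * apply cdiff_plus; [apply cdiff_id|apply cdiff_const].
      * now apply cdiff_inv.
Qed.

(** On the circle of radius [d] the numerator [F w - F z] is at most [2 * M]; the maximum principle
    carries the quotient bound inside, through the centre where [q] is merely continuous. *)
Lemma slope_bound (F q : C -> C) (z : C) (d M : R) :
  0 < d -> (forall w, cdiff F w) -> slope F q z ->
  (forall w, Cmod (w - z) <= d -> Cmod (F w) <= M) ->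
  forall w, Cmod (w - z) <= d -> Cmod (q w) <= 2 * M / d.
Proof.
  intros Hd HF Hq HM.
  assert (HqE := proj2 Hq).
  apply maximum_principle with (Cmod z + d).
  - apply closed_real_le, real_cont_dist.
  - intros w. apply Cmod_le_dist.
  - intros w _. destruct (Ceq_dec w z) as [->|Hw]; [apply Hq|].
    now apply cdiff_cont, (slope_cdiff F q z).
  - intros w Hw. destruct (Rle_lt_or_eq_dec _ _ Hw) as [Hlt|Heq].
    + right. destruct (Ceq_dec w z) as [->|Hne].
      * exists d. split; [exact Hd|]. intros u Hu. split; [exact Hu|].
        now apply (slope_cdiff F q z).
      * assert (Hp := proj1 (Cmod_gt_0 _) (Cminus_neq0 _ _ Hne)).
        exists (Rmin (Cmod (w - z) / 2) (d - Cmod (w - z))).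
        split; [apply Rmin_glb_lt; lra|]. intros u Hu.
        assert (H1 := Rle_trans _ _ _ Hu (Rmin_l _ _)).
        assert (H2 := Rle_trans _ _ _ Hu (Rmin_r _ _)).
        split.
        -- generalize (Cmod_minus_triangle u w z). lra.
        -- intros _. apply (slope_cdiff F q z); auto. intros ->.
           rewrite Cmod_minus_sym in H1. lra.
    + left. assert (E : Cmod (q w) * d <= 2 * M).
      { rewrite <- Heq at 1. rewrite <- Cmod_mult, <- HqE.
        apply Rle_trans with (1 := Cmod_triangle _ _). rewrite Cmod_opp.
        assert (Cmod (F z) <= M).
        { apply HM. replace (z - z)%C with (RtoC 0) by ring. rewrite Cmod_0. lra. }
        assert (Cmod (F w) <= M) by (apply HM; lra). lra. }
      apply Rmult_le_reg_r with d; [exact Hd|].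
      replace (2 * M / d * d) with (2 * M) by (field; lra). exact E.
Qed.

Lemma lipschitz_bound (F : C -> C) (z : C) (d M : R) :
  0 < d -> (forall w, cdiff F w) -> (forall w, Cmod (w - z) <= d -> Cmod (F w) <= M) ->
  forall w, Cmod (w - z) <= d -> Cmod (F w - F z) <= 2 * M / d * Cmod (w - z).
Proof.
  intros Hd HF HM w Hw. destruct (HF z) as (q & Hq).
  rewrite (proj2 Hq), Cmod_mult. apply Rmult_le_compat_r; [apply Cmod_ge_0|].
  now apply (slope_bound F q z).
Qed.

Lemma cauchy_estimate (F : C -> C) (z l : C) (d M : R) :
  0 < d -> (forall w, cdiff F w) -> is_derive F z l ->
  (forall w, Cmod (w - z) <= d -> Cmod (F w) <= M) -> Cmod l <= 2 * M / d.
Proof.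
  intros Hd HF Hl HM. destruct (is_derive_slope _ _ _ Hl) as (q & Hq & <-).
  apply (slope_bound F q z); auto.
  replace (z - z)%C with (RtoC 0) by ring. rewrite Cmod_0. lra.
Qed.

Lemma three_circles (F : C -> C) (z : C) (s v m M B : R) (q : nat) :
  0 < s -> (forall w, cdiff F w) ->
  (forall w, Cmod (w - z) <= s -> Cmod (F w) <= m) ->
  (forall w, Cmod (w - z) <= v -> Cmod (F w) <= M) ->
  m <= B * s ^ q -> M <= B * v ^ q ->
  forall w, s <= Cmod (w - z) <= v -> Cmod (F w) <= B * Cmod (w - z) ^ q.
Proof.
  intros Hs HF Hm HM HBs HBv.
  set (G := fun w => (F w * (/ (w + - z)) ^ q)%C).
  assert (pos : forall w, s <= Cmod (w - z) -> (w - z)%C <> 0%C).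
  { intros w Hw. apply Cmod_gt_0. lra. }
  assert (GE : forall w, s <= Cmod (w - z) -> Cmod (G w) = Cmod (F w) / Cmod (w - z) ^ q).
  { intros w Hw. unfold G. rewrite Cmod_mult, Cmod_pow.
    change (w + - z)%C with (w - z)%C. rewrite Cmod_inv by auto.
    rewrite pow_inv. reflexivity. }
  assert (Gd : forall w, s <= Cmod (w - z) -> cdiff G w).
  { intros w Hw. apply cdiff_mult; [apply HF|]. apply cdiff_pow. apply (cdiff_comp Cinv).
    - apply cdiff_plus; [apply cdiff_id|apply cdiff_const].
    - apply cdiff_inv. now apply pos. }
  assert (P : forall w, s <= Cmod (w - z) -> 0 < Cmod (w - z) ^ q) by (intros; apply pow_lt; lra).
  assert (key : forall w, s <= Cmod (w - z) /\ Cmod (w - z) <= v -> Cmod (G w) <= B).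
  { apply maximum_principle with (Cmod z + v).
    - apply closed_and; [apply closed_real_ge|apply closed_real_le]; apply real_cont_dist.
    - intros w Hw. now apply Cmod_le_dist.
    - intros w Hw. apply cdiff_cont, Gd. lra.
    - intros w [H1 H2].
      assert (bound : forall b, Cmod (F w) <= B * Cmod (w - z) ^ q -> b = Cmod (G w) -> b <= B).
      { intros b Hb ->. rewrite GE by lra. apply Rmult_le_reg_r with (Cmod (w - z) ^ q); auto.
        unfold Rdiv. rewrite Rmult_assoc, Rinv_l, Rmult_1_r; [exact Hb|].
        apply Rgt_not_eq. now apply P. }
      destruct (Rle_lt_or_eq_dec _ _ H1) as [L1|E1].
      2:{ left. apply (bound _); [|reflexivity]. rewrite <- E1.
          apply Rle_trans with (2 := HBs). apply Hm. lra. }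
      destruct (Rle_lt_or_eq_dec _ _ H2) as [L2|E2].
      2:{ left. apply (bound _); [|reflexivity]. rewrite E2.
          apply Rle_trans with (2 := HBv). apply HM. lra. }
      right. exists (Rmin (Cmod (w - z) - s) (v - Cmod (w - z))).
      split; [apply Rmin_glb_lt; lra|]. intros u Hu.
      assert (U1 := Rle_trans _ _ _ Hu (Rmin_l _ _)).
      assert (U2 := Rle_trans _ _ _ Hu (Rmin_r _ _)).
      generalize (Cmod_minus_triangle u w z) (Cmod_minus_triangle w u z).
      rewrite (Cmod_minus_sym w u). intros T1 T2.
      split; [lra|]. intros _. apply Gd. lra. }
  intros w Hw. specialize (key w Hw). rewrite GE in key by lra.
  replace (Cmod (F w)) with (Cmod (F w) / Cmod (w - z) ^ q * Cmod (w - z) ^ q)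
    by (field; apply Rgt_not_eq, P; lra).
  apply Rmult_le_compat_r; [left; apply P; lra|exact key].
Qed.

(** [2 * a] is the fixed point of the map from [M] to [a + M / 2]. The lemma serves the solution [f]
    with [a = 0] and the coefficient [h0] with the net bound as [a]. *)
Lemma contraction_iterate (F : C -> C) (z0 : C) (S d a M0 : R) :
  0 <= a -> 0 <= d -> 0 <= M0 ->
  (forall z M, Cmod (z - z0) <= S - d -> (forall w, Cmod (w - z) <= d -> Cmod (F w) <= M) ->
     Cmod (F z) <= a + M / 2) ->
  (forall w, Cmod (w - z0) <= S -> Cmod (F w) <= M0) ->
  forall k z, Cmod (z - z0) <= S - INR k * d -> Cmod (F z) <= 2 * a + (1 / 2) ^ k * M0.
Proof.
  intros Ha Hd HM Hstep H0. induction k as [|k IH]; intros z Hz.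
  - simpl in *. assert (Cmod (F z) <= M0) by (apply H0; lra). lra.
  - rewrite S_INR in Hz. assert (0 <= INR k * d) by (apply Rmult_le_pos; [apply pos_INR|exact Hd]).
    eapply Rle_trans; [apply (Hstep z (2 * a + (1 / 2) ^ k * M0))|].
    + lra.
    + intros w Hw. apply IH. generalize (Cmod_minus_triangle w z z0). lra.
    + simpl. lra.
Qed.

(** * Complex powers on the right half-plane *)

Definition clog (w : C) : C := (ln (Cmod w), atan (Im w / Re w)).

Lemma cexp_clog (w : C) : 0 < Re w -> cexp (clog w) = w.
Proof.
  intros Hw. destruct w as [x y]; simpl in Hw.
  assert (Hm : 0 < Cmod (x, y)).
  { apply Rlt_le_trans with (Rabs x); [|exact (re_le_Cmod (x, y))]. rewrite Rabs_pos_eq; lra. }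
  unfold cexp, clog; simpl. rewrite exp_ln by exact Hm.
  rewrite cos_atan, sin_atan.
  assert (E : Cmod (x, y) = x * sqrt (1 + Rsqr (y / x))).
  { unfold Cmod; simpl.
    replace (x * (x * 1) + y * (y * 1)) with (x ^ 2 * (1 + Rsqr (y / x)))
      by (unfold Rsqr; field; lra).
    rewrite sqrt_mult_alt, sqrt_pow2 by (try apply pow2_ge_0; lra). reflexivity. }
  assert (Hs : 0 < sqrt (1 + Rsqr (y / x))).
  { apply sqrt_lt_R0. generalize (Rle_0_sqr (y / x)). lra. }
  rewrite E. f_equal; field; lra.
Qed.

Lemma cont_pair (g h : C -> R) (z : C) :
  real_cont g z -> real_cont h z -> cont (fun w => (g w, h w)) z.
Proof.
  intros Hg Hh e He. destruct (Hg (e / 2)) as (d1 & D1 & H1); [lra|].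
  destruct (Hh (e / 2)) as (d2 & D2 & H2); [lra|].
  exists (Rmin d1 d2). split; [now apply Rmin_glb_lt|]. intros w Hw.
  apply Cmod_pair_lt; simpl.
  - apply H1. apply Rlt_le_trans with (1 := Hw), Rmin_l.
  - apply H2. apply Rlt_le_trans with (1 := Hw), Rmin_r.
Qed.

Lemma real_cont_comp (phi : R -> R) (g : C -> R) (z : C) :
  continuity_pt phi (g z) -> real_cont g z -> real_cont (fun w => phi (g w)) z.
Proof.
  intros Hphi Hg e He. destruct (Hphi e He) as (d & D & Hd).
  destruct (Hg d D) as (d' & D' & Hd'). exists d'. split; [exact D'|]. intros w Hw.
  destruct (Req_dec (g z) (g w)) as [E|E].
  - rewrite <- E, Rminus_diag, Rabs_R0. exact He.
  - apply Hd. split; [split; [exact I|exact E]|]. now apply Hd'.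
Qed.

Lemma real_cont_mult (g h : C -> R) (z : C) :
  real_cont g z -> real_cont h z -> real_cont (fun w => g w * h w) z.
Proof.
  intros Hg Hh.
  assert (L : forall k : C -> R, real_cont k z -> cont (fun w => RtoC (k w)) z).
  { intros k Hk. apply cont_pair; [exact Hk|]. intros e He. exists 1. split; [lra|].
    intros. rewrite Rminus_diag, Rabs_R0. exact He. }
  intros e He. destruct (cont_mult _ _ z (L g Hg) (L h Hh) e He) as (d & D & Hd).
  exists d. split; [exact D|]. intros w Hw. specialize (Hd w Hw).
  rewrite <- !RtoC_mult, <- RtoC_minus, Cmod_R in Hd. exact Hd.
Qed.

Lemma Re_pos_neq0 (w : C) : 0 < Re w -> w <> 0%C.
Proof. intros H ->. simpl in H. lra. Qed.

Lemma clog_cont (w : C) : 0 < Re w -> cont clog w.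
Proof.
  intros Hw. apply cont_pair.
  - apply (real_cont_comp ln).
    + apply continuity_pt_filterlim. apply (continuous_ln (Cmod w)).
      now apply Cmod_gt_0, Re_pos_neq0.
    + apply (real_cont_Cmod (fun w => w)), cont_id.
  - apply (real_cont_comp atan).
    + apply derivable_continuous_pt, derivable_pt_atan.
    + apply real_cont_mult; [apply (real_cont_Im (fun w => w)), cont_id|].
      apply (real_cont_comp Rinv); [|apply (real_cont_Re (fun w => w)), cont_id].
      apply continuity_pt_inv with (f := fun x => x); [|lra].
      apply derivable_continuous_pt, derivable_pt_id.
Qed.

(** Inverse function rule: the slope is the reciprocal of that of [cexp]. A zero of the latter at
    [clog u] would force [u = w], where its value is [w] and hence nonzero. *)
Lemma cdiff_clog (w : C) : 0 < Re w -> cdiff clog w.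
Proof.
  intros Hw. destruct (cexp_slope (clog w)) as (q & (Hc & Hq) & Hqw).
  rewrite cexp_clog in Hqw by exact Hw.
  assert (Hne := Re_pos_neq0 w Hw).
  apply slope_local with (fun u => / q (clog u))%C.
  - apply cont_comp with (F := Cinv) (G := fun u => q (clog u)).
    + apply cont_comp with (F := q); [now apply clog_cont|exact Hc].
    + rewrite Hqw. now apply cont_inv.
  - exists (Re w). split; [exact Hw|]. intros u Hu.
    assert (Hur : 0 < Re u).
    { generalize (re_le_Cmod (u - w)). rewrite Re_minus. intros K.
      assert (K' := Rle_lt_trans _ _ _ K Hu). apply Rabs_def2 in K'. lra. }
    assert (E := Hq (clog u)). rewrite !cexp_clog in E by assumption.
    assert (Hqu : q (clog u) <> 0%C).
    { intros K. assert (u = w).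
      { replace u with (w + (u - w))%C by ring. rewrite E, K. ring. }
      subst u. rewrite Hqw in K. contradiction. }
    rewrite E. field. exact Hqu.
Qed.

Definition cpow (w : C) (b : R) : C := cexp (RtoC b * clog w).

Lemma cdiff_cpow (b : R) (w : C) : 0 < Re w -> cdiff (fun u => cpow u b) w.
Proof.
  intros Hw. apply (cdiff_comp cexp); [|apply cdiff_cexp].
  apply cdiff_mult; [apply cdiff_const|now apply cdiff_clog].
Qed.

Lemma Re_cpow_le (b : R) (w : C) : Re (cpow w b) <= Rpower (Cmod w) b.
Proof.
  apply Rle_trans with (1 := Rle_abs _). apply Rle_trans with (1 := re_le_Cmod _).
  unfold cpow. rewrite Cmod_cexp, Re_mult. simpl. rewrite Rmult_0_l, Rminus_0_r. apply Rle_refl.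
Qed.

(** The argument of [w] is below [PI / 2] in absolute value, so that of the power is at most
    [b * (PI / 2)]. For [b < 1] the real part is thus comparable to the modulus, as a comparison
    function requires. *)
Lemma Re_cpow_ge (b : R) (w : C) : 0 <= b <= 1 ->
  cos (b * (PI / 2)) * Rpower (Cmod w) b <= Re (cpow w b).
Proof.
  intros Hb. unfold cpow, cexp. rewrite Re_mult, Im_mult. simpl.
  rewrite !Rmult_0_l, Rminus_0_r, Rplus_0_r, Rmult_comm.
  change (exp (b * ln (Cmod w))) with (Rpower (Cmod w) b).
  apply Rmult_le_compat_l; [left; apply exp_pos|].
  set (t := atan _).
  assert (Ht : - (PI / 2) < t < PI / 2)
    by (generalize (atan_bound (Im w / Re w)); unfold t; lra).
  assert (HPI := PI_RGT_0).
  destruct (Rle_lt_dec 0 t).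
  - apply cos_decr_1; nra.
  - rewrite <- (cos_neg (b * t)). apply cos_decr_1; nra.
Qed.

Lemma cos_half_angle_pos (b : R) : 0 <= b < 1 -> 0 < cos (b * (PI / 2)).
Proof. intros Hb. assert (HPI := PI_RGT_0). apply cos_gt_0; nra. Qed.

(** * Comparison of growth rates *)

(** The threshold is at least 1 so that powers of [r] are monotone in the exponent throughout. *)
Definition eventually_R (P : R -> Prop) : Prop := exists R0, 1 <= R0 /\ forall r, R0 <= r -> P r.

Lemma eventually_and (P Q : R -> Prop) :
  eventually_R P -> eventually_R Q -> eventually_R (fun r => P r /\ Q r).
Proof.
  intros (R1 & O1 & H1) (R2 & O2 & H2). exists (Rmax R1 R2).
  generalize (Rmax_l R1 R2) (Rmax_r R1 R2). intros.
  split; [lra|]. intros r Hr. split; [apply H1|apply H2]; lra.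
Qed.

Lemma eventually_mono (P Q : R -> Prop) :
  (forall r, 1 <= r -> P r -> Q r) -> eventually_R P -> eventually_R Q.
Proof.
  intros HPQ (R1 & O1 & H1). exists R1. split; [exact O1|].
  intros r Hr. apply HPQ; [lra|auto].
Qed.

Lemma eventually_ge (M : R) : eventually_R (fun r => M <= r).
Proof.
  exists (Rmax 1 M). split; [apply Rmax_l|]. intros r. apply Rle_trans, Rmax_r.
Qed.

Lemma Rpower_pos (x y : R) : 0 < Rpower x y.
Proof. apply exp_pos. Qed.

Lemma Rpower_ge_1 (r s : R) : 1 <= r -> 0 <= s -> 1 <= Rpower r s.
Proof. intros Hr Hs. rewrite <- (Rpower_O r) by lra. now apply Rle_Rpower. Qed.

Lemma eventually_power (K s t : R) :
  s < t -> eventually_R (fun r => K * Rpower r s <= Rpower r t).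
Proof.
  intros Hst. set (M := Rmax 1 K). assert (M1 : 1 <= M) by apply Rmax_l.
  assert (MK : K <= M) by apply Rmax_r.
  apply eventually_mono with (2 := eventually_ge (Rpower M (/ (t - s)))).
  intros r Hr1 Hr. replace t with ((t - s) + s) by ring. rewrite Rpower_plus.
  apply Rmult_le_compat_r; [left; apply Rpower_pos|].
  apply Rle_trans with (1 := MK).
  replace M with (Rpower (Rpower M (/ (t - s))) (t - s)).
  - apply Rle_Rpower_l; [lra|]. split; [apply Rpower_pos|exact Hr].
  - rewrite Rpower_mult, Rinv_l, Rpower_1; lra.
Qed.

Lemma exp_le_compat (x y : R) : x <= y -> exp x <= exp y.
Proof. intros [H| ->]; [left; now apply exp_increasing|apply Rle_refl]. Qed.

Lemma ln_le_linear (x : R) : 0 < x -> ln x <= x.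
Proof.
  intros Hx. generalize (exp_ineq1_le (ln x)). rewrite exp_ln by exact Hx. lra.
Qed.

Lemma ln_le_Rpower (b r : R) : 0 < b -> 1 <= r -> ln r <= / b * Rpower r b.
Proof.
  intros Hb Hr. assert (H := ln_le_linear (Rpower r b) (Rpower_pos _ _)).
  rewrite ln_Rpower in H. apply Rmult_le_reg_l with b; [exact Hb|].
  rewrite <- Rmult_assoc, Rinv_r, Rmult_1_l by lra. exact H.
Qed.

Lemma ln_ge_0 (r : R) : 1 <= r -> 0 <= ln r.
Proof. intros H. rewrite <- ln_1. apply ln_le; lra. Qed.

Lemma eventually_exp (K p a : R) :
  0 < a -> eventually_R (fun r => K * Rpower r p <= exp (Rpower r a)).
Proof.
  intros Ha. set (M := Rmax 1 K). assert (M1 : 1 <= M) by apply Rmax_l.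
  assert (MK : K <= M) by apply Rmax_r. assert (LM := ln_ge_0 M M1).
  set (b := a / 2).
  apply eventually_mono with (2 := eventually_power (Rabs p * / b + ln M) b a ltac:(unfold b; lra)).
  intros r Hr H.
  assert (Hb : 0 < b) by (unfold b; lra).
  apply Rle_trans with (exp (ln M + p * ln r)).
  - rewrite exp_plus, exp_ln by lra. apply Rmult_le_compat_r; [left; apply Rpower_pos|exact MK].
  - apply exp_le_compat. apply Rle_trans with (2 := H).
    assert (L0 := ln_ge_0 r Hr). assert (L1 := ln_le_Rpower b r Hb Hr).
    assert (G1 := Rpower_ge_1 r b Hr ltac:(lra)).
    assert (p * ln r <= Rabs p * (/ b * Rpower r b)).
    { apply Rle_trans with (Rabs p * ln r).
      - apply Rmult_le_compat_r; [exact L0|apply Rle_abs].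
      - apply Rmult_le_compat_l; [apply Rabs_pos|exact L1]. }
    assert (ln M <= ln M * Rpower r b) by nra.
    rewrite Rmult_plus_distr_r, Rmult_assoc. lra.
Qed.

Lemma le_of_le_exp_eps (x B Y : R) :
  0 < B -> 0 <= Y -> (forall eps, 0 < eps -> x <= B * exp (eps * Y)) -> x <= B.
Proof.
  intros HB HY H. apply Rnot_lt_le. intros Hlt.
  assert (Hq : 1 < x / B).
  { apply Rmult_lt_reg_r with B; [exact HB|]. unfold Rdiv. rewrite Rmult_assoc, Rinv_l; lra. }
  assert (L : 0 < ln (x / B)) by (rewrite <- ln_1; apply ln_increasing; lra).
  assert (K := H (ln (x / B) / (Y + 1) / 2)
    ltac:(repeat apply Rdiv_lt_0_compat; lra)).
  assert (K2 : exp (ln (x / B) / (Y + 1) / 2 * Y) < x / B).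
  { rewrite <- (exp_ln (x / B)) at 2 by lra. apply exp_increasing.
    replace (ln (x / B)) with (ln (x / B) / (Y + 1) * (Y + 1)) at 2 by (field; lra).
    set (u := ln (x / B) / (Y + 1)). assert (0 < u) by (apply Rdiv_lt_0_compat; lra). nra. }
  assert (B * exp (ln (x / B) / (Y + 1) / 2 * Y) < B * (x / B)) by (apply Rmult_lt_compat_l; lra).
  replace (B * (x / B)) with x in * by (field; lra). lra.
Qed.

(** * A Phragmén–Lindelöf principle *)

(* The comparison functions are powers of [P], which maps the domain into the right half-plane:
   the one with exponent [s / N] absorbs the bound on [Re P = 1], the one with exponent [beta]
   dominates [h] on large circles. *)
Lemma phragmen_lindelof (P h : C -> C) (N c1 c2 s tau R0 : R) :
  (forall z, cdiff P z) -> (forall z, cdiff h z) -> 1 <= R0 -> 0 < c1 ->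
  (forall z, R0 <= Cmod z -> c1 * Rpower (Cmod z) N <= Cmod (P z) <= c2 * Rpower (Cmod z) N) ->
  0 < s < N -> tau < N ->
  (forall z, R0 <= Cmod z -> Cmod (h z) <= exp (Rpower (Cmod z) tau)) ->
  (forall z, R0 <= Cmod z -> Re (P z) = 1 -> Cmod (h z) <= exp (Rpower (Cmod z) s)) ->
  exists K, forall z, R0 <= Cmod z -> 1 <= Re (P z) -> Cmod (h z) <= exp (K * Rpower (Cmod z) s).
Proof.
  intros HP Hh HR0 Hc1 HPN Hs Htau Hgrow Hbd.
  set (al := s / N).
  set (t0 := Rmax tau 0). assert (Ht0 : tau <= t0 /\ 0 <= t0 < N).
  { unfold t0. repeat split; [apply Rmax_l|apply Rmax_r|apply Rmax_lub_lt; lra]. }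
  (* Midway between [t0 / N] and 1: large enough that [N * be] exceeds the growth exponent [tau],
     small enough for a positive real part. *)
  set (be := (t0 / N + 1) / 2).
  assert (Hal : 0 < al < 1).
  { unfold al. split; [apply Rdiv_lt_0_compat; lra|].
    apply Rmult_lt_reg_r with N; [lra|]. replace (s / N * N) with s by (field; lra). lra. }
  assert (HtN : 0 <= t0 / N < 1).
  { split; [apply Rmult_le_pos; [lra|left; apply Rinv_0_lt_compat; lra]|].
    apply Rmult_lt_reg_r with N; [lra|]. replace (t0 / N * N) with t0 by (field; lra). lra. }
  assert (Hbe : 0 < be < 1) by (unfold be; lra).
  assert (HbeN : tau < N * be).
  { unfold be. replace (N * ((t0 / N + 1) / 2)) with ((t0 + N) / 2) by (field; lra). lra. }
  set (ka := cos (al * (PI / 2)) * Rpower c1 al).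
  set (kb := cos (be * (PI / 2)) * Rpower c1 be).
  assert (Hka : 0 < ka).
  { apply Rmult_lt_0_compat; [apply cos_half_angle_pos; lra|apply Rpower_pos]. }
  assert (Hkb : 0 < kb).
  { apply Rmult_lt_0_compat; [apply cos_half_angle_pos; lra|apply Rpower_pos]. }
  assert (lower : forall b z, 0 < b < 1 -> R0 <= Cmod z ->
    cos (b * (PI / 2)) * Rpower c1 b * Rpower (Cmod z) (N * b) <= Re (cpow (P z) b)).
  { intros b z Hb Hz. apply Rle_trans with (2 := Re_cpow_ge b (P z) ltac:(lra)).
    rewrite Rmult_assoc. apply Rmult_le_compat_l; [left; apply cos_half_angle_pos; lra|].
    rewrite <- Rpower_mult, Rpower_mult_distr by (auto; apply Rpower_pos).
    apply Rle_Rpower_l; [lra|]. split; [|now apply HPN].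
    apply Rmult_lt_0_compat; [exact Hc1|apply Rpower_pos]. }
  assert (HalN : N * al = s) by (unfold al; field; lra).
  (* Normalised so that [A * Re (cpow (P z) al)] is at least [Cmod z ^ s]. *)
  set (A := / ka). assert (HA : 0 < A) by now apply Rinv_0_lt_compat.
  set (M0 := exp (Rpower R0 tau)).
  assert (HM0 : 1 <= M0).
  { unfold M0. rewrite <- exp_0. apply exp_le_compat. left; apply Rpower_pos. }
  assert (key : forall z eps, R0 <= Cmod z -> 1 <= Re (P z) -> 0 < eps ->
    Cmod (h z) <= M0 * exp (A * Re (cpow (P z) al)) * exp (eps * Re (cpow (P z) be))).
  { intros z eps Hz HPz He.
    set (E := fun w => (RtoC (- A) * cpow (P w) al + RtoC (- eps) * cpow (P w) be)%C).
    set (H := fun w => (h w * cexp (E w))%C).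
    assert (ReE : forall w, Re (E w) = - A * Re (cpow (P w) al) - eps * Re (cpow (P w) be)).
    { intros w. unfold E.
      change (Re (RtoC (- A) * cpow (P w) al) + Re (RtoC (- eps) * cpow (P w) be) =
        - A * Re (cpow (P w) al) - eps * Re (cpow (P w) be)).
      rewrite !Re_mult. simpl. ring. }
    assert (ReE1 : forall w, R0 <= Cmod w -> Re (E w) <= - Rpower (Cmod w) s /\
      Re (E w) <= - (eps * kb * Rpower (Cmod w) (N * be))).
    { intros w Hw. rewrite ReE. assert (L1 := lower al w Hal Hw).
      assert (L2 := lower be w Hbe Hw). fold ka in L1. fold kb in L2. rewrite HalN in L1.
      assert (X1 : Rpower (Cmod w) s <= A * Re (cpow (P w) al)).
      { replace (Rpower (Cmod w) s) with (A * (ka * Rpower (Cmod w) s)) by (unfold A; field; lra).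
        apply Rmult_le_compat_l; lra. }
      assert (X2 : eps * kb * Rpower (Cmod w) (N * be) <= eps * Re (cpow (P w) be)).
      { rewrite Rmult_assoc. apply Rmult_le_compat_l; lra. }
      assert (0 < Rpower (Cmod w) s) by apply Rpower_pos.
      assert (0 < eps * kb * Rpower (Cmod w) (N * be))
        by (apply Rmult_lt_0_compat; [now apply Rmult_lt_0_compat|apply Rpower_pos]).
      lra. }
    destruct (eventually_power (/ (eps * kb)) tau (N * be) HbeN) as (R1 & _ & HR1).
    set (R2 := Rmax R1 (Cmod z)).
    assert (HR2 : R1 <= R2 /\ Cmod z <= R2) by (split; [apply Rmax_l|apply Rmax_r]).
    assert (Hd : forall w, 1 <= Re (P w) -> cdiff H w).
    { intros w Hw. apply cdiff_mult; [apply Hh|]. apply (cdiff_comp cexp); [|apply cdiff_cexp].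
      apply cdiff_plus; (apply cdiff_mult; [apply cdiff_const|]);
        apply (cdiff_comp (fun u => cpow u _)); auto; apply cdiff_cpow; lra. }
    assert (HC : forall w, real_cont (fun u => Cmod u) w).
    { intros w. apply (real_cont_Cmod (fun u => u)), cont_id. }
    assert (HRe : forall w, real_cont (fun u => Re (P u)) w).
    { intros w. apply real_cont_Re, cdiff_cont, HP. }
    assert (MP : Cmod (H z) <= M0).
    { apply (maximum_principle H (fun w => (R0 <= Cmod w /\ Cmod w <= R2) /\ 1 <= Re (P w)) R2).
      - apply closed_and; [apply closed_and|]; (apply closed_real_ge || apply closed_real_le); auto.
      - intros w Hw. apply Hw.
      - intros w Hw. apply cdiff_cont, Hd, Hw.
      - intros w [[W1 W2] W3].
        assert (HB : forall x, Cmod (h w) <= exp x -> x + Re (E w) <= Rpower R0 tau -> Cmod (H w) <= M0).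
        { intros x X1 X2. unfold H. rewrite Cmod_mult, Cmod_cexp.
          apply Rle_trans with (exp x * exp (Re (E w))).
          - apply Rmult_le_compat_r; [left; apply exp_pos|exact X1].
          - rewrite <- exp_plus. now apply exp_le_compat. }
        destruct (ReE1 w W1) as [E1 E2].
        assert (P0 := Rpower_pos R0 tau). assert (P1 := Rpower_pos (Cmod w) s).
        destruct (Rle_lt_or_eq_dec _ _ W1) as [L1|Q1].
        2:{ left. apply (HB _ (Hgrow w W1)). rewrite <- Q1 at 1. lra. }
        destruct (Rle_lt_or_eq_dec _ _ W3) as [L3|Q3].
        2:{ left. apply (HB _ (Hbd w W1 (eq_sym Q3))). lra. }
        destruct (Rle_lt_or_eq_dec _ _ W2) as [L2|Q2].
        2:{ left. apply (HB _ (Hgrow w W1)).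
            assert (X := HR1 (Cmod w) ltac:(lra)).
            apply Rmult_le_compat_l with (r := eps * kb) in X; [|left; now apply Rmult_lt_0_compat].
            rewrite <- Rmult_assoc, Rinv_r, Rmult_1_l in X
              by (apply Rgt_not_eq; now apply Rmult_lt_0_compat). lra. }
        right.
        destruct (real_cont_gt _ w R0 (HC w) L1) as (r1 & Hr1 & B1).
        destruct (real_cont_lt _ w R2 (HC w) L2) as (r2 & Hr2 & B2).
        destruct (real_cont_gt _ w 1 (HRe w) L3) as (r3 & Hr3 & B3).
        exists (Rmin r1 (Rmin r2 r3)). split; [repeat apply Rmin_glb_lt; assumption|].
        intros u Hu.
        assert (U1 := Rle_trans _ _ _ Hu (Rmin_l _ _)).
        assert (U23 := Rle_trans _ _ _ Hu (Rmin_r _ _)).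
        assert (U2 := Rle_trans _ _ _ U23 (Rmin_l _ _)).
        assert (U3 := Rle_trans _ _ _ U23 (Rmin_r _ _)).
        specialize (B1 u U1). specialize (B2 u U2). specialize (B3 u U3).
        split; [lra|]. intros _. apply Hd. lra.
      - lra. }
    unfold H in MP. rewrite Cmod_mult, Cmod_cexp, ReE in MP.
    set (x := A * Re (cpow (P z) al)) in *. set (y := eps * Re (cpow (P z) be)) in *.
    replace (- A * Re (cpow (P z) al) - y) with (- (x + y)) in MP by (unfold x; ring).
    rewrite exp_Ropp in MP. rewrite Rmult_assoc, <- exp_plus.
    assert (X := exp_pos (x + y)).
    apply Rmult_le_reg_r with (/ exp (x + y)); [now apply Rinv_0_lt_compat|].
    rewrite Rmult_assoc, Rinv_r, Rmult_1_r by lra. exact MP. }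
  exists (Rpower R0 tau + A * Rpower c2 al). intros z Hz HPz.
  assert (G1 := Rpower_ge_1 (Cmod z) s ltac:(lra) ltac:(lra)).
  apply Rle_trans with (M0 * exp (A * Re (cpow (P z) al))).
  - apply le_of_le_exp_eps with (Re (cpow (P z) be)).
    + apply Rmult_lt_0_compat; [lra|apply exp_pos].
    + apply Rle_trans with (2 := lower be z Hbe Hz). left.
      apply Rmult_lt_0_compat; [exact Hkb|apply Rpower_pos].
    + intros eps He. now apply key.
  - unfold M0. rewrite <- exp_plus. apply exp_le_compat.
    rewrite Rmult_plus_distr_r. apply Rplus_le_compat.
    + assert (0 < Rpower R0 tau) by apply Rpower_pos. nra.
    + rewrite Rmult_assoc. apply Rmult_le_compat_l; [lra|].
      apply Rle_trans with (1 := Re_cpow_le _ _). rewrite <- HalN, <- Rpower_mult.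
      destruct (HPN z Hz) as [N1 N2].
      assert (0 < c1 * Rpower (Cmod z) N) by (apply Rmult_lt_0_compat; [lra|apply Rpower_pos]).
      assert (0 < c2).
      { apply Rmult_lt_reg_r with (Rpower (Cmod z) N); [apply Rpower_pos|lra]. }
      rewrite Rpower_mult_distr by (auto; apply Rpower_pos).
      apply Rle_Rpower_l; lra.
Qed.

(** * The coefficient [h0] on the critical strip *)

Lemma is_derive_cdiff (F : C -> C) (z l : C) : is_derive F z l -> cdiff F z.
Proof. intros H. destruct (is_derive_slope _ _ _ H) as (q & Hq & _). now exists q. Qed.

Lemma half_pow_le_exp (k : nat) : (1 / 2) ^ k <= exp (- (INR k / 2)).
Proof.
  assert (H : 1 / 2 <= exp (- (1 / 2))).
  { assert (P := exp_pos (- (1 / 2))).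
    assert (E : exp (- (1 / 2)) * exp (- (1 / 2)) * exp 1 = 1).
    { rewrite <- !exp_plus, <- exp_0. f_equal. lra. }
    assert (E3 := exp_le_3). assert (E1 := exp_pos 1). nra. }
  replace (exp (- (INR k / 2))) with (exp (- (1 / 2)) ^ k).
  - apply pow_incr. lra.
  - rewrite <- Rpower_pow by apply exp_pos. unfold Rpower. rewrite ln_exp. f_equal. lra.
Qed.

Lemma exp_le_two_pow (k : nat) : exp (INR k / 2) <= 2 ^ k.
Proof.
  assert (H := half_pow_le_exp k). rewrite exp_Ropp in H.
  assert (P := exp_pos (INR k / 2)). assert (P2 : 0 < 2 ^ k) by (apply pow_lt; lra).
  replace ((1 / 2) ^ k) with (/ 2 ^ k) in H.
  - rewrite <- (Rinv_inv (2 ^ k)), <- (Rinv_inv (exp _)).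
    apply Rinv_le_contravar; [now apply Rinv_0_lt_compat|exact H].
  - rewrite <- pow_inv. f_equal. lra.
Qed.

Lemma nat_between (x : R) : 0 <= x -> exists k, x <= INR k <= x + 1.
Proof.
  intros Hx. destruct (nfloor_ex x Hx) as (k & Hk). exists (S k).
  rewrite S_INR. lra.
Qed.

(* Where [|B|] is huge, [f = - (f'' + A f') / B] and Cauchy's estimates make [f] contract each
   time the disc shrinks by [2 d]. *)
Lemma solution_small (f f1 f2 A B : C -> C) (z1 : C) (e d a b M0 : R) :
  (forall z, is_derive f z (f1 z)) -> (forall z, is_derive f1 z (f2 z)) ->
  (forall z, (f2 z + A z * f1 z + B z * f z)%C = 0%C) ->
  0 < d -> 0 < b -> 0 <= M0 -> 4 / d ^ 2 + 2 * a / d <= b / 2 ->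
  (forall w, Cmod (w - z1) <= e -> Cmod (A w) <= a) ->
  (forall w, Cmod (w - z1) <= e -> b <= Cmod (B w)) ->
  (forall w, Cmod (w - z1) <= e -> Cmod (f w) <= M0) ->
  forall k w, INR k * (2 * d) <= e / 2 -> Cmod (w - z1) <= e / 2 ->
  Cmod (f w) <= (1 / 2) ^ k * M0.
Proof.
  intros Hf1 Hf2 Hode Hd Hb HM0 Hab HA HB Hf k w Hk Hw.
  assert (Df := fun z => is_derive_cdiff _ _ _ (Hf1 z)).
  assert (Df1 := fun z => is_derive_cdiff _ _ _ (Hf2 z)).
  replace ((1 / 2) ^ k * M0) with (2 * 0 + (1 / 2) ^ k * M0) by ring.
  apply (contraction_iterate f z1 e (2 * d) 0 M0); auto; try lra.
  intros z M Hz HM.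
  assert (self : forall u : C, Cmod (u - u) = 0).
  { intros u. replace (u - u)%C with (RtoC 0) by ring. apply Cmod_0. }
  assert (M_ge : 0 <= M).
  { apply Rle_trans with (Cmod (f z)); [apply Cmod_ge_0|]. apply HM. rewrite self. lra. }
  (* One radius [d] is spent on passing from [f] to [f1] and another from [f1] to [f2], hence the
     step [2 * d]. *)
  assert (F1 : forall u, Cmod (u - z) <= d -> Cmod (f1 u) <= 2 * M / d).
  { intros u Hu. apply (cauchy_estimate f u (f1 u)); auto. intros v Hv. apply HM.
    generalize (Cmod_minus_triangle v u z). lra. }
  assert (F2 : Cmod (f2 z) <= 2 * (2 * M / d) / d) by now apply (cauchy_estimate f1 z).
  assert (Fz := F1 z ltac:(rewrite self; lra)).
  assert (Az := HA z ltac:(lra)). assert (Bz := HB z ltac:(lra)).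
  assert (E : (B z * f z)%C = (- (f2 z + A z * f1 z))%C).
  { replace (B z * f z)%C with ((f2 z + A z * f1 z + B z * f z) - (f2 z + A z * f1 z))%C by ring.
    rewrite Hode. ring. }
  assert (L : Cmod (B z) * Cmod (f z) <= 2 * (2 * M / d) / d + a * (2 * M / d)).
  { rewrite <- Cmod_mult, E, Cmod_opp. apply Rle_trans with (1 := Cmod_triangle _ _).
    rewrite Cmod_mult. apply Rplus_le_compat; [exact F2|].
    apply Rmult_le_compat; auto using Cmod_ge_0. }
  replace (2 * (2 * M / d) / d + a * (2 * M / d)) with ((4 / d ^ 2 + 2 * a / d) * M) in L
    by (field; lra).
  apply Rmult_le_reg_l with b; [exact Hb|].
  apply Rle_trans with (Cmod (B z) * Cmod (f z)).
  - apply Rmult_le_compat_r; [apply Cmod_ge_0|exact Bz].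
  - apply Rle_trans with (1 := L). replace (b * (0 + M / 2)) with (b / 2 * M) by field.
    now apply Rmult_le_compat_r.
Qed.

(** Three circles about [z1] with [B = kap * (2 / v) ^ q]: this majorant equals [kap] at radius
    [v / 2] and [kap * 2 ^ q] at radius [v]. If it also held at radius [s], it would give
    [Cmod (f z) <= kap]. *)
Lemma not_too_small (f : C -> C) (z z1 : C) (s v m M kap : R) (q : nat) :
  (forall w, cdiff f w) -> 0 < s -> 0 < v ->
  (forall w, Cmod (w - z1) <= s -> Cmod (f w) <= m) ->
  (forall w, Cmod (w - z1) <= v -> Cmod (f w) <= M) ->
  s <= Cmod (z - z1) <= v / 2 -> kap < Cmod (f z) -> 0 < kap ->
  M <= kap * 2 ^ q -> kap * (2 * s / v) ^ q < m.
Proof.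
  intros Hf Hs Hv Hm HM Hz Hk Hk0 HMq. apply Rnot_le_lt. intros Hmq.
  assert (Hpow : forall u, kap * (2 / v) ^ q * u ^ q = kap * (2 * u / v) ^ q).
  { intros u. rewrite Rmult_assoc, <- Rpow_mult_distr. do 2 f_equal. field. lra. }
  assert (H := three_circles f z1 s v m M (kap * (2 / v) ^ q) q Hs Hf Hm HM).
  rewrite !Hpow in H.
  replace (2 * v / v) with 2 in H by (field; lra).
  specialize (H Hmq HMq z ltac:(lra)).
  assert (kap * (2 / v) ^ q * Cmod (z - z1) ^ q <= kap * 1).
  { rewrite Rmult_assoc, <- Rpow_mult_distr. apply Rmult_le_compat_l; [lra|].
    rewrite <- (pow1 q). apply pow_incr. split.
    - apply Rmult_le_pos; [|apply Cmod_ge_0]. left. apply Rdiv_lt_0_compat; lra.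
    - replace 1 with (2 / v * (v / 2)) by (field; lra).
      apply Rmult_le_compat_l; [left; apply Rdiv_lt_0_compat|]; lra. }
  lra.
Qed.

Lemma bound_in_disc (F : C -> C) (r M : R) :
  (forall z, cdiff F z) -> (forall z, Cmod z = r -> Cmod (F z) <= M) ->
  forall z, Cmod z <= r -> Cmod (F z) <= M.
Proof.
  intros HF HM.
  assert (HC : forall w, real_cont (fun u => Cmod u) w).
  { intros w. apply (real_cont_Cmod (fun u => u)), cont_id. }
  apply maximum_principle with r; auto.
  - now apply closed_real_le.
  - intros z _. now apply cdiff_cont.
  - intros z Hz. destruct (Rle_lt_or_eq_dec _ _ Hz) as [L|E]; [right|left; auto].
    destruct (real_cont_lt _ z r (HC z) L) as (d & D & Hd).
    exists d. split; [exact D|]. intros w Hw. split; [left; auto|auto].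
Qed.

Section CriticalStrip.
Variables (f f1 f2 h1 h0 P P1 : C -> C) (zs : C).
Variables (c k s1 s2 tau rho c2 N R0 : R).
Hypothesis P_diff : forall z, cdiff P z.
Hypothesis h0_diff : forall z, cdiff h0 z.
Hypothesis f_derive : forall z, is_derive f z (f1 z).
Hypothesis f1_derive : forall z, is_derive f1 z (f2 z).
Hypothesis ode :
  forall z, (f2 z + h1 z * cexp (P1 z) * f1 z + h0 z * cexp (P z) * f z)%C = 0%C.
Hypothesis P1_le : forall z, Re (P1 z) <= c * Re (P z) + k.
Hypothesis c_ge : 0 <= c.
Hypothesis R0_ge : 1 <= R0.
Hypothesis c2_ge : 0 <= c2.
Hypothesis exponents : 0 <= N /\ 0 <= tau /\ 0 <= rho /\ 0 <= s1 /\ s1 < s2.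
Hypothesis P_bound : forall z, R0 <= Cmod z -> Cmod (P z) <= c2 * Rpower (Cmod z) N.
Hypothesis h1_bound : forall z, R0 <= Cmod z -> Cmod (h1 z) <= exp (Rpower (Cmod z) s1).
Hypothesis h0_bound : forall z, R0 <= Cmod z -> Cmod (h0 z) <= exp (Rpower (Cmod z) tau).
Hypothesis f_bound : forall z, R0 <= Cmod z -> Cmod (f z) <= exp (Rpower (Cmod z) rho).
Hypothesis f_nonzero : f zs <> 0%C.

(* Around [z0] with [r = Cmod z0] three scales are used: the disc of radius [/ X r] stays in the
   strip, [/ X r ^ 2] is the fineness of the net, [/ X r ^ 4] the step in Cauchy's estimates. *)
Let a := (s1 + s2) / 2.
Let X r := exp (Rpower r a).
Let kap := Cmod (f zs) / 2.

Lemma Rpower_scale (t r p : R) : 0 < t -> 0 < r -> Rpower (t * r) p = Rpower t p * Rpower r p.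
Proof. intros Ht Hr. symmetry. now apply Rpower_mult_distr. Qed.

Lemma Rpower_le_scale (x r p : R) : 0 <= p -> 1 <= r -> 0 < x <= 2 * r ->
  Rpower x p <= Rpower 2 p * Rpower r p.
Proof. intros Hp Hr Hx. rewrite <- Rpower_scale by lra. now apply Rle_Rpower_l. Qed.

Let large r :=
  R0 + 1 <= r /\ 4 * Cmod zs <= r /\ 200 <= X r /\ 4 * r <= X r /\
  2 * c2 * Rpower 2 N * Rpower r N <= X r /\
  2 * c + k + Rpower 2 s1 * Rpower r s1 <= Rpower r a /\
  Rpower 2 tau * Rpower r tau + 1 <= X r / 8 /\
  10 * Rpower r a <= Rpower r s2 /\
  Rpower 6 rho * Rpower r rho + Rabs (ln kap) +
    3 * (2 * (Rpower 6 rho * Rpower r rho + Rabs (ln kap)) + 1) * Rpower r a + 1 / 2 <= X r.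

Lemma eventually_large : eventually_R large.
Proof.
  assert (Ha : 0 < a /\ s1 < a < s2) by (unfold a; lra).
  assert (EX : forall K p, eventually_R (fun r => K * Rpower r p <= X r)).
  { intros. apply eventually_exp, Ha. }
  repeat apply eventually_and.
  - apply eventually_ge.
  - apply eventually_ge.
  - apply eventually_mono with (2 := EX 200 0). intros r Hr. now rewrite Rpower_O, Rmult_1_r by lra.
  - apply eventually_mono with (2 := EX 4 1). intros r Hr. now rewrite Rpower_1 by lra.
  - apply EX.
  - apply eventually_mono with (2 := eventually_power (Rabs (2 * c + k) + Rpower 2 s1) s1 a ltac:(lra)).
    intros r Hr H. apply Rle_trans with (2 := H). rewrite Rmult_plus_distr_r.
    apply Rplus_le_compat_r. assert (G := Rpower_ge_1 r s1 Hr ltac:(lra)).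
    generalize (Rle_abs (2 * c + k)) (Rabs_pos (2 * c + k)). nra.
  - apply eventually_mono with (2 := EX (8 * (Rpower 2 tau + 1)) tau). intros r Hr H.
    assert (G := Rpower_ge_1 r tau Hr ltac:(lra)). lra.
  - apply eventually_power. lra.
  - set (y6 := Rpower 6 rho). set (l := Rabs (ln kap)).
    apply eventually_mono with (2 := EX (y6 + l + 3 * (2 * (y6 + l) + 1) + 1 / 2) (rho + a)).
    intros r Hr H. apply Rle_trans with (2 := H). rewrite Rpower_plus.
    assert (G1 := Rpower_ge_1 r rho Hr ltac:(lra)). assert (G2 := Rpower_ge_1 r a Hr ltac:(lra)).
    assert (Y : 0 < y6) by apply Rpower_pos. assert (L : 0 <= l) by apply Rabs_pos.
    set (u := Rpower r rho) in *. set (w := Rpower r a) in *.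
    assert (u <= u * w) by nra. assert (w <= u * w) by nra. assert (1 <= u * w) by nra.
    assert (y6 * u <= y6 * (u * w)) by (apply Rmult_le_compat_l; lra).
    assert (l * 1 <= l * (u * w)) by (apply Rmult_le_compat_l; lra).
    assert (l * w <= l * (u * w)) by (apply Rmult_le_compat_l; lra). lra.
Qed.

Section Point.
Variable z0 : C.
Let r := Cmod z0.
Hypothesis r_large : large r.
Hypothesis z0_strip : Rabs (Re (P z0)) <= 1.

Lemma near_modulus (w : C) : Cmod (w - z0) <= 1 -> R0 <= Cmod w /\ 0 < Cmod w <= 2 * r.
Proof.
  intros Hw. destruct r_large as (L1 & _). generalize (Cmod_le_minus w z0) (Cmod_le_minus z0 w).
  rewrite (Cmod_minus_sym z0). fold r. lra.
Qed.

Lemma X_inv_le_1 : 0 < / X r <= 1.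
Proof.
  destruct r_large as (_ & _ & L & _). split; [apply Rinv_0_lt_compat; lra|].
  rewrite <- Rinv_1. apply Rinv_le_contravar; lra.
Qed.

(** [P] has Lipschitz constant at most [X r] about [z0], by its growth on the unit disc there, so a
    displacement of [/ X r] changes it by at most 1. *)
Lemma strip_Re (w : C) : Cmod (w - z0) <= / X r -> Rabs (Re (P w)) <= 2.
Proof.
  intros Hw. assert (HX := X_inv_le_1).
  destruct r_large as (L1 & _ & LX & _ & L & _).
  assert (D := lipschitz_bound P z0 1 (c2 * (Rpower 2 N * Rpower r N)) Rlt_0_1 P_diff).
  assert (Cmod (P w - P z0) <= 1).
  { eapply Rle_trans; [apply D|].
    - intros u Hu. destruct (near_modulus u Hu) as [U1 U2].
      apply Rle_trans with (1 := P_bound u U1). apply Rmult_le_compat_l; [exact c2_ge|].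
      apply Rpower_le_scale; lra.
    - lra.
    - apply Rle_trans with (X r * / X r); [|right; apply Rinv_r; lra].
      apply Rmult_le_compat; [|apply Cmod_ge_0|lra|exact Hw].
      unfold Rdiv. rewrite Rinv_1, Rmult_1_r.
      repeat apply Rmult_le_pos; try lra; left; apply Rpower_pos. }
  assert (K := Rle_trans _ _ _ (re_le_Cmod _) H). rewrite Re_minus in K.
  apply Rabs_le_between in K. apply Rabs_le_between in z0_strip. apply Rabs_le. lra.
Qed.

Lemma strip_coefficient (w : C) : Cmod (w - z0) <= / X r -> Cmod (h1 w * cexp (P1 w)) <= X r.
Proof.
  intros Hw. assert (HX := X_inv_le_1). assert (HRe := strip_Re w Hw).
  apply Rabs_le_between in HRe. destruct (near_modulus w ltac:(lra)) as [U1 U2].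
  destruct r_large as (L1 & _ & _ & _ & _ & L & _).
  rewrite Cmod_mult, Cmod_cexp.
  apply Rle_trans with (exp (Rpower 2 s1 * Rpower r s1) * exp (2 * c + k)).
  - apply Rmult_le_compat; try apply Cmod_ge_0; [left; apply exp_pos| |].
    + apply Rle_trans with (1 := h1_bound w U1). apply exp_le_compat, Rpower_le_scale; lra.
    + apply exp_le_compat. apply Rle_trans with (1 := P1_le w). nra.
  - rewrite <- exp_plus. apply exp_le_compat. lra.
Qed.

(** The factor 6 leaves room for discs of radius [4 * r] about any centre at distance at most 1 from
    [z0]. *)
Lemma f_disc_bound (w : C) : Cmod w <= 6 * r -> Cmod (f w) <= exp (Rpower 6 rho * Rpower r rho).
Proof.
  destruct r_large as (L1 & _). rewrite <- Rpower_scale by lra.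
  apply bound_in_disc.
  - intros z. now apply (is_derive_cdiff f z (f1 z)).
  - intros z Hz. rewrite <- Hz. apply f_bound. lra.
Qed.

(** Otherwise [f] is halved about [X ^ 2 / 4] times on the disc about [z1]. Three circles with outer
    radius [4 * r], compared at the fixed point [zs] where [f] does not vanish, forbid such a small
    value. *)
Lemma h0_small_nearby (z1 : C) : Cmod (z1 - z0) <= / X r - / X r ^ 2 ->
  exists w, Cmod (w - z1) <= / X r ^ 2 /\ Cmod (h0 w) <= X r ^ 9.
Proof.
  intros Hz1. apply NNPP. intros Hno.
  assert (HX := X_inv_le_1).
  assert (big : forall w, Cmod (w - z1) <= / X r ^ 2 -> X r ^ 9 < Cmod (h0 w)).
  { intros w Hw. apply Rnot_le_lt. intros H. apply Hno. now exists w. }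
  destruct r_large as (L1 & L2 & L3 & L4 & _ & _ & _ & _ & L9).
  assert (Df := fun z => is_derive_cdiff _ _ _ (f_derive z)).
  set (x := X r) in *. set (y := Rpower 6 rho * Rpower r rho) in *.
  assert (x2 : 0 < x ^ 2) by (apply pow_lt; lra).
  assert (Hx2 : 0 < / x ^ 2) by now apply Rinv_0_lt_compat.
  assert (Hx2' : / x ^ 2 <= 1).
  { rewrite <- Rinv_1. apply Rinv_le_contravar; [lra|]. apply pow_R1_Rle. lra. }
  assert (near : forall w, Cmod (w - z1) <= / x ^ 2 -> Cmod (w - z0) <= / x).
  { intros w Hw. generalize (Cmod_minus_triangle w z1 z0). lra. }
  assert (y_pos : 0 < y) by (apply Rmult_lt_0_compat; apply Rpower_pos).
  assert (z1r : Cmod z1 <= r + 1 /\ r - 1 <= Cmod z1).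
  { generalize (Cmod_le_minus z1 z0) (Cmod_le_minus z0 z1). rewrite (Cmod_minus_sym z0). fold r. lra. }
  assert (M_bound : forall w, Cmod (w - z1) <= 4 * r -> Cmod (f w) <= exp y).
  { intros w Hw. apply f_disc_bound. generalize (Cmod_le_minus w z1). lra. }
  (* This many steps of length [2 * / x ^ 4] fit into half the radius [/ x ^ 2]. *)
  destruct (nfloor_ex (x ^ 2 / 4)) as (n & Hn); [lra|].
  assert (tiny : forall w, Cmod (w - z1) <= / x ^ 2 / 2 -> Cmod (f w) <= (1 / 2) ^ n * exp y).
  (* The 9 in the denominator is a bound for [exp 2], since [Re P >= -2] here. Cauchy's estimates
     cost [4 * x ^ 8 + 2 * x ^ 5], and the ninth power leaves one factor [x >= 200] to absorb the
     constants. *)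
  { intros w. apply (solution_small f f1 f2 (fun z => h1 z * cexp (P1 z))%C
      (fun z => h0 z * cexp (P z))%C z1 (/ x ^ 2) (/ x ^ 4) x (x ^ 9 / 9) (exp y)); auto.
    - apply Rinv_0_lt_compat, pow_lt. lra.
    - apply Rdiv_lt_0_compat; [apply pow_lt; lra|lra].
    - left; apply exp_pos.
    - replace (4 / (/ x ^ 4) ^ 2 + 2 * x / / x ^ 4) with (4 * x ^ 8 + 2 * x ^ 5) by (field; lra).
      assert (0 < x ^ 8) by (apply pow_lt; lra).
      assert (x ^ 5 <= x ^ 8) by (apply Rle_pow; [lra|lia]).
      replace (x ^ 9) with (x * x ^ 8) by ring. nra.
    - intros u Hu. now apply strip_coefficient, near.
    - intros u Hu. rewrite Cmod_mult, Cmod_cexp.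
      assert (HRe := strip_Re u (near u Hu)). apply Rabs_le_between in HRe.
      apply Rmult_le_compat; [apply pow_le; lra|lra|left; auto|].
      apply Rle_trans with (exp (-2)); [|now apply exp_le_compat].
      replace (-2) with (- (1 + 1)) by ring. rewrite exp_Ropp, exp_plus.
      assert (E3 := exp_le_3). assert (E1 := exp_pos 1).
      apply Rinv_le_contravar; nra.
    - intros u Hu. apply M_bound. lra.
    - replace (INR n * (2 * / x ^ 4)) with (INR n * (2 / x ^ 2) * / x ^ 2) by (field; lra).
      unfold Rdiv at 2. rewrite (Rmult_comm (/ x ^ 2)).
      apply Rmult_le_compat_r; [lra|]. apply Rmult_le_reg_r with (x ^ 2); [exact x2|].
      replace (INR n * (2 / x ^ 2) * x ^ 2) with (2 * INR n) by (field; lra). lra. }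
  assert (kap0 : 0 < kap).
  { unfold kap. apply Rdiv_lt_0_compat; [now apply Cmod_gt_0|lra]. }
  set (l := Rabs (ln kap)) in *.
  assert (kap_l : exp (- l) <= kap).
  { rewrite <- (exp_ln kap) by exact kap0. apply exp_le_compat. unfold l.
    generalize (Rle_abs (- ln kap)). rewrite Rabs_Ropp. lra. }
  assert (l0 : 0 <= l) by apply Rabs_pos.
  (* Chosen so that [exp (q / 2) >= exp (y + l)], which makes [kap * 2 ^ q] dominate the bound
     [exp y] of [f]. *)
  destruct (nat_between (2 * (y + l))) as (q & Hq); [lra|].
  assert (contra : kap * (2 * (/ x ^ 2 / 2) / (4 * r)) ^ q < (1 / 2) ^ n * exp y).
  { apply (not_too_small f zs z1) with (M := exp y); auto; try lra.
    - generalize (Cmod_le_minus z1 zs) (Cmod_triangle zs (- z1)).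
      rewrite Cmod_opp, (Cmod_minus_sym z1). change (zs + - z1)%C with (zs - z1)%C.
      lra.
    - unfold kap. generalize (proj1 (Cmod_gt_0 _) f_nonzero). lra.
    - apply Rle_trans with (exp (- l) * exp (INR q / 2)).
      + rewrite <- exp_plus. apply exp_le_compat. lra.
      + apply Rmult_le_compat; try (left; apply exp_pos); [exact kap_l|apply exp_le_two_pow]. }
  apply Rlt_not_le in contra. apply contra.
  apply Rle_trans with (exp (- (INR n / 2)) * exp y).
  { apply Rmult_le_compat_r; [left; apply exp_pos|apply half_pow_le_exp]. }
  apply Rle_trans with (exp (- l) * exp (- (INR q * (3 * Rpower r a)))).
  (* By the choice of [n], [n / 2] exceeds [x ^ 2 / 8 - 1 / 2]; the half lost by rounding is the
     [1 / 2] in the last clause of [large]. *)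
  - rewrite <- !exp_plus. apply exp_le_compat.
    assert (G := Rpower_pos r a). set (w := Rpower r a) in *.
    assert (INR q * (3 * w) <= (2 * (y + l) + 1) * (3 * w)) by (apply Rmult_le_compat_r; lra).
    nra.
  - apply Rmult_le_compat; try (left; apply exp_pos); [exact kap_l|].
    replace (exp (- (INR q * (3 * Rpower r a)))) with ((/ x ^ 3) ^ q).
    + apply pow_incr. split; [left; apply Rinv_0_lt_compat, pow_lt; lra|].
      replace (2 * (/ x ^ 2 / 2) / (4 * r)) with (/ (4 * r * x ^ 2)) by (field; lra).
      apply Rinv_le_contravar; [apply Rmult_lt_0_compat; lra|].
      replace (x ^ 3) with (x * x ^ 2) by ring. apply Rmult_le_compat_r; lra.
    + rewrite <- pow_inv, <- pow_mult. unfold x, X. rewrite <- exp_Ropp.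
      rewrite <- Rpower_pow by apply exp_pos. unfold Rpower at 1. rewrite ln_exp.
      f_equal. rewrite mult_INR. simpl. ring.
Qed.

(** From a net point at distance [/ X ^ 2] the Lipschitz bound on radius [4 * / X ^ 2] gives
    [X ^ 9 + M / 2]; the 4 is what produces the factor 1/2. About [X / 4] such steps fit into radius
    [/ X] and reduce the a priori bound to [2 * X ^ 9 + 1]. *)
Lemma h0_strip_bound_at : Cmod (h0 z0) <= exp (Rpower r s2).
Proof.
  assert (HX := X_inv_le_1).
  assert (small := h0_small_nearby).
  destruct r_large as (L1 & _ & L3 & _ & _ & _ & L7 & L8 & _).
  assert (EX : X r ^ 10 <= exp (Rpower r s2)).
  { unfold X. rewrite <- Rpower_pow by apply exp_pos. unfold Rpower at 1. rewrite ln_exp.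
    apply exp_le_compat. simpl. lra. }
  set (x := X r) in *. set (y := Rpower 2 tau * Rpower r tau) in *.
  assert (x2 : 0 < x ^ 2) by (apply pow_lt; lra).
  assert (Hx2 : 0 < / x ^ 2) by now apply Rinv_0_lt_compat.
  assert (self : forall u : C, Cmod (u - u) = 0).
  { intros u. replace (u - u)%C with (RtoC 0) by ring. apply Cmod_0. }
  destruct (nfloor_ex (x / 4)) as (n & Hn); [lra|].
  assert (H : Cmod (h0 z0) <= 2 * x ^ 9 + (1 / 2) ^ n * exp y).
  { apply (contraction_iterate h0 z0 (/ x) (4 * / x ^ 2) (x ^ 9) (exp y)).
    - apply pow_le. lra.
    - lra.
    - left; apply exp_pos.
    - intros z M Hz HM.
      assert (M_ge : 0 <= M).
      { apply Rle_trans with (Cmod (h0 z)); [apply Cmod_ge_0|]. apply HM. rewrite self. lra. }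
      destruct (small z ltac:(lra)) as (w & Hw & Hw9).
      assert (Lip := lipschitz_bound h0 z (4 * / x ^ 2) M ltac:(lra) h0_diff HM w ltac:(lra)).
      apply Rle_trans with (1 := Cmod_le_minus (h0 z) (h0 w)). rewrite Cmod_minus_sym.
      apply Rplus_le_compat; [exact Hw9|]. apply Rle_trans with (1 := Lip).
      replace (M / 2) with (2 * M / (4 * / x ^ 2) * / x ^ 2) by (field; lra).
      apply Rmult_le_compat_l; [|exact Hw].
      apply Rmult_le_pos; [lra|left; apply Rinv_0_lt_compat; lra].
    - intros w Hw. destruct (near_modulus w ltac:(lra)) as [U1 U2].
      apply Rle_trans with (1 := h0_bound w U1). apply exp_le_compat, Rpower_le_scale; lra.
    - rewrite self. replace (INR n * (4 * / x ^ 2)) with (4 * INR n * / x * / x) by (field; lra).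
      assert (4 * INR n * / x <= 1).
      { apply Rmult_le_reg_r with x; [lra|]. rewrite Rmult_assoc, Rinv_l; lra. }
      nra. }
  assert (K : (1 / 2) ^ n * exp y <= 1).
  { apply Rle_trans with (exp (- (INR n / 2)) * exp y).
    - apply Rmult_le_compat_r; [left; apply exp_pos|apply half_pow_le_exp].
    - rewrite <- exp_plus, <- exp_0. apply exp_le_compat. lra. }
  apply Rle_trans with (2 := EX). assert (1 <= x ^ 9) by (apply pow_R1_Rle; lra).
  replace (x ^ 10) with (x * x ^ 9) by ring. nra.
Qed.
End Point.

Lemma h0_strip_bound :
  eventually_R (fun r => forall z, Cmod z = r -> Rabs (Re (P z)) <= 1 ->
    Cmod (h0 z) <= exp (Rpower r s2)).
Proof.
  apply eventually_mono with (2 := eventually_large). intros r _ Hr z <- Hz.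
  now apply h0_strip_bound_at.
Qed.
End CriticalStrip.

(** * Polynomials *)

Lemma peval_S (a : nat -> C) (n : nat) (z : C) :
  peval a (S n) z = (peval a n z + a (S n) * pow_n z (S n))%C.
Proof. unfold peval. now rewrite sum_Sn. Qed.

Lemma Cmod_pow_n (z : C) (k : nat) : Cmod (pow_n z k) = Cmod z ^ k.
Proof.
  induction k as [|k IH]; simpl.
  - exact Cmod_1.
  - rewrite <- IH. exact (Cmod_mult z (pow_n z k)).
Qed.

Lemma cdiff_pow_n (k : nat) (z : C) : cdiff (fun w => pow_n w k) z.
Proof.
  induction k as [|k IH].
  - exact (cdiff_const 1%C z).
  - exact (cdiff_mult (fun w => w) _ z (cdiff_id z) IH).
Qed.

Lemma cdiff_peval (a : nat -> C) (n : nat) (z : C) : cdiff (peval a n) z.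
Proof.
  induction n as [|n IH].
  - apply cdiff_ext with (fun w => a 0%nat * pow_n w 0)%C.
    + intros w. unfold peval. now rewrite sum_O.
    + apply cdiff_mult; [apply cdiff_const|apply cdiff_pow_n].
  - apply cdiff_ext with (fun w => peval a n w + a (S n) * pow_n w (S n))%C.
    + intros w. now rewrite peval_S.
    + apply cdiff_plus; [exact IH|]. apply cdiff_mult; [apply cdiff_const|apply cdiff_pow_n].
Qed.

Lemma peval_upper (a : nat -> C) (n : nat) :
  exists K, 0 <= K /\ forall z, 1 <= Cmod z -> Cmod (peval a n z) <= K * Cmod z ^ n.
Proof.
  induction n as [|n (K & HK & IH)].
  - exists (Cmod (a 0%nat)). split; [apply Cmod_ge_0|]. intros z _. right.
    unfold peval. rewrite sum_O, Cmod_mult, Cmod_pow_n. reflexivity.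
  - exists (K + Cmod (a (S n))). split; [generalize (Cmod_ge_0 (a (S n))); lra|]. intros z Hz.
    rewrite peval_S. apply Rle_trans with (1 := Cmod_triangle _ _).
    rewrite Cmod_mult, Cmod_pow_n, Rmult_plus_distr_r. apply Rplus_le_compat_r.
    apply Rle_trans with (1 := IH z Hz). apply Rmult_le_compat_l; [exact HK|].
    apply Rle_pow; [exact Hz|lia].
Qed.

Lemma peval_lower (a : nat -> C) (n : nat) : (1 <= n)%nat -> a n <> 0%C ->
  eventually_R (fun r => forall z, Cmod z = r -> Cmod (a n) / 2 * r ^ n <= Cmod (peval a n z)).
Proof.
  intros Hn Ha. destruct n as [|n]; [lia|]. apply Cmod_gt_0 in Ha.
  destruct (peval_upper a n) as (K & HK & HU).
  apply eventually_mono with (2 := eventually_ge (2 * K / Cmod (a (S n)))).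
  intros r Hr1 Hr z Hz.
  assert (P := HU z ltac:(lra)). rewrite Hz in P.
  assert (T : Cmod (a (S n)) * r ^ S n <= Cmod (peval a (S n) z) + Cmod (peval a n z)).
  { rewrite <- Hz, <- Cmod_pow_n, <- Cmod_mult.
    replace (a (S n) * pow_n z (S n))%C with (peval a (S n) z + - peval a n z)%C
      by (rewrite peval_S; ring).
    apply Rle_trans with (1 := Cmod_triangle _ _). rewrite Cmod_opp. apply Rle_refl. }
  assert (rn : 0 < r ^ n) by (apply pow_lt; lra).
  assert (K' : K <= Cmod (a (S n)) / 2 * r).
  { apply Rmult_le_compat_r with (r := Cmod (a (S n)) / 2) in Hr; [|lra].
    replace (2 * K / Cmod (a (S n)) * (Cmod (a (S n)) / 2)) with K in Hr by (field; lra). lra. }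
  assert (K * r ^ n <= Cmod (a (S n)) / 2 * r * r ^ n) by (apply Rmult_le_compat_r; lra).
  simpl in *. lra.
Qed.

(** * Maximum modulus, order and lower order *)

(** [real] sends an infinite supremum to 0, so finiteness has to be shown: the extreme value theorem
    bounds the set above, and the point [r] itself makes it nonempty. *)
Lemma maxmod_spec (g : C -> C) (r : R) : (forall z, cdiff g z) -> 0 <= r ->
  (forall z, Cmod z = r -> Cmod (g z) <= maxmod g r) /\
  (forall M, (forall z, Cmod z = r -> Cmod (g z) <= M) -> maxmod g r <= M).
Proof.
  intros Hg Hr. unfold maxmod. set (E := fun y => _).
  assert (HC : forall w, real_cont (fun u => Cmod u) w).
  { intros w. apply (real_cont_Cmod (fun u => u)), cont_id. }
  destruct (extreme_value (fun z => r <= Cmod z /\ Cmod z <= r) (fun z => Cmod (g z)) r)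
    as (zm & _ & Hmax).
  { apply closed_and; [now apply closed_real_ge|now apply closed_real_le]. }
  { tauto. }
  { exists (RtoC r). rewrite Cmod_R, Rabs_pos_eq by exact Hr. split; apply Rle_refl. }
  { intros z _. apply real_cont_Cmod, cdiff_cont, Hg. }
  assert (U : is_ub_Rbar E (Finite (Cmod (g zm)))).
  { intros y (z & Hz & ->). apply Hmax. rewrite Hz. split; apply Rle_refl. }
  destruct (Lub_Rbar_correct E) as [L1 L2].
  assert (Emem : E (Cmod (g (RtoC r)))).
  { exists (RtoC r). split; [|reflexivity]. rewrite Cmod_R. now apply Rabs_pos_eq. }
  assert (B := L2 _ U). assert (Bm := L1 _ Emem).
  destruct (Lub_Rbar E) as [l| |]; [|contradiction|contradiction]. simpl. split.
  - intros z Hz. apply (L1 (Cmod (g z))). now exists z.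
  - intros M HM. apply (L2 (Finite M)). intros y (z & Hz & ->). now apply HM.
Qed.

Lemma le_exp_of_logp (y t : R) : logp y <= t -> y <= exp t.
Proof.
  intros H. destruct (Rle_lt_dec y 0) as [Hy|Hy].
  - generalize (exp_pos t). lra.
  - rewrite <- (exp_ln y) by exact Hy. apply exp_le_compat.
    apply Rle_trans with (2 := H). apply Rmax_l.
Qed.

Lemma logp_le_of_exp (y t : R) : 0 <= t -> y <= exp t -> logp y <= t.
Proof.
  intros Ht H. apply Rmax_lub; [|exact Ht]. destruct (Rle_lt_dec y 0) as [Hy|Hy].
  (* At non-positive arguments [ln] is 0 by definition. *)
  - unfold ln. destruct (Rlt_dec 0 y); [exfalso; lra|exact Ht].
  - rewrite <- (ln_exp t). now apply ln_le.
Qed.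

Lemma logp_ge_0 (y : R) : 0 <= logp y.
Proof. apply Rmax_r. Qed.

Lemma ln_pos (r : R) : 2 <= r -> 0 < ln r.
Proof. intros H. rewrite <- ln_1. apply ln_increasing; lra. Qed.

(** The infimum in [limsup_inf] runs over finite tail suprema only. If no tail had a finite supremum
    it would be the infimum of the empty set, [p_infty]; below [L] it therefore provides a real
    bound on a tail. *)
Lemma order_witness (g : C -> C) (L : Rbar) : Rbar_lt (order g) L ->
  exists s R0, Rbar_lt (Finite s) L /\ forall r, R0 <= r -> ord_ratio g r <= s.
Proof.
  intros H. apply NNPP. intros Hno. apply (Rbar_lt_not_le _ _ H).
  unfold order, limsup_inf. destruct (Glb_Rbar_correct (fun x => exists R0 : R,
    Lub_Rbar (fun y => exists r, R0 <= r /\ y = ord_ratio g r) = Finite x)) as [_ G].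
  apply G. intros s (R0 & Hs). apply Rbar_not_lt_le. intros Hlt. apply Hno.
  exists s, R0. split; [exact Hlt|]. intros r Hr.
  destruct (Lub_Rbar_correct (fun y => exists r, R0 <= r /\ y = ord_ratio g r)) as [U _].
  rewrite Hs in U. apply (U (ord_ratio g r)). now exists r.
Qed.

Lemma order_infinite (g : C -> C) : ~ Rbar_lt (order g) p_infty -> order g = p_infty.
Proof. destruct (order g); simpl; tauto. Qed.

(** That [s] is at most the lower order is recorded as well, so that the upper bound 1/2 passes to
    [s]. *)
Lemma lower_order_witness (g : C -> C) (L : Rbar) : Rbar_lt L (lower_order g) ->
  exists s R0, Rbar_lt L (Finite s) /\ Rbar_le (Finite s) (lower_order g) /\
    forall r, R0 <= r -> s <= ord_ratio g r.
Proof.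
  intros H. apply NNPP. intros Hno. apply (Rbar_lt_not_le _ _ H).
  unfold lower_order, liminf_inf in *. set (S := fun x => _) in *.
  destruct (Lub_Rbar_correct S) as [U G].
  apply G. intros s Hs. apply Rbar_not_lt_le. intros Hlt. apply Hno.
  assert (Us := U s Hs). destruct Hs as (R0 & Hs).
  exists s, R0. split; [exact Hlt|]. split; [exact Us|]. intros r Hr.
  destruct (Glb_Rbar_correct (fun y => exists r, R0 <= r /\ y = ord_ratio g r)) as [V _].
  rewrite Hs in V. apply (V (ord_ratio g r)). now exists r.
Qed.

Lemma growth_of_ord_ratio (g : C -> C) (s R0 : R) : (forall z, cdiff g z) ->
  (forall r, R0 <= r -> ord_ratio g r <= s) ->
  0 <= s /\ eventually_R (fun r => forall z, Cmod z = r -> Cmod (g z) <= exp (Rpower r s)).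
Proof.
  intros Hg H.
  assert (B : forall r, 2 <= r -> R0 <= r -> logp (logp (maxmod g r)) <= s * ln r).
  { intros r Hr Hr0. assert (L := ln_pos r Hr). specialize (H r Hr0). unfold ord_ratio in H.
    apply Rmult_le_compat_r with (r := ln r) in H; [|lra].
    unfold Rdiv in H. now rewrite Rmult_assoc, Rinv_l, Rmult_1_r in H by lra. }
  split.
  - set (r := Rmax 2 R0). assert (H2 : 2 <= r) by apply Rmax_l.
    assert (K := B r H2 (Rmax_r _ _)). assert (L := ln_pos r H2).
    generalize (logp_ge_0 (logp (maxmod g r))). intros.
    apply Rmult_le_reg_r with (ln r); [exact L|]. lra.
  - apply eventually_mono with (2 := eventually_ge (Rmax 2 R0)).
    intros r _ Hr z Hz. assert (H2 := Rle_trans _ _ _ (Rmax_l _ _) Hr).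
    apply Rle_trans with (maxmod g r).
    + apply maxmod_spec; auto. lra.
    + apply le_exp_of_logp, le_exp_of_logp, B; [exact H2|].
      apply Rle_trans with (2 := Hr), Rmax_r.
Qed.

Lemma ord_ratio_of_growth (g : C -> C) (s : R) : (forall z, cdiff g z) -> 0 <= s ->
  eventually_R (fun r => forall z, Cmod z = r -> Cmod (g z) <= exp (Rpower r s)) ->
  eventually_R (fun r => ord_ratio g r <= s).
Proof.
  intros Hg Hs H.
  apply eventually_mono with (2 := eventually_and _ _ H (eventually_ge 2)).
  intros r _ [Hr H2]. assert (L := ln_pos r H2). unfold ord_ratio.
  apply Rmult_le_reg_r with (ln r); [exact L|].
  unfold Rdiv. rewrite Rmult_assoc, Rinv_l, Rmult_1_r by lra.
  apply logp_le_of_exp; [apply Rmult_le_pos; lra|].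
  apply logp_le_of_exp; [left; apply exp_pos|].
  apply maxmod_spec; auto. lra.
Qed.

(* On [|Re P| <= 1] the bound comes from [h0_strip_bound]; the two remaining regions
   [Re P >= 1] and [Re (- P) >= 1] are handled by [phragmen_lindelof]. *)
Lemma coefficient_growth (f f1 f2 h1 h0 P P1 : C -> C) (zs : C)
  (c k s1 s2 tau rho c1 c2 N : R) :
  (forall z, cdiff P z) -> (forall z, cdiff h0 z) ->
  (forall z, is_derive f z (f1 z)) -> (forall z, is_derive f1 z (f2 z)) ->
  (forall z, (f2 z + h1 z * cexp (P1 z) * f1 z + h0 z * cexp (P z) * f z)%C = 0%C) ->
  (forall z, Re (P1 z) <= c * Re (P z) + k) -> 0 <= c -> 0 < c1 -> 0 <= c2 ->
  0 <= tau < N -> 0 <= rho -> 0 <= s1 < s2 -> s2 < N ->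
  eventually_R (fun r => forall z, Cmod z = r ->
    c1 * Rpower r N <= Cmod (P z) <= c2 * Rpower r N) ->
  eventually_R (fun r => forall z, Cmod z = r -> Cmod (h1 z) <= exp (Rpower r s1)) ->
  eventually_R (fun r => forall z, Cmod z = r -> Cmod (h0 z) <= exp (Rpower r tau)) ->
  eventually_R (fun r => forall z, Cmod z = r -> Cmod (f z) <= exp (Rpower r rho)) ->
  f zs <> 0%C ->
  exists K, eventually_R (fun r => forall z, Cmod z = r -> Cmod (h0 z) <= exp (K * Rpower r s2)).
Proof.
  intros DP D0 Hf1 Hf2 Hode HP1 Hc Hc1 Hc2 Htau Hrho Hs Hs2 EP E1 E0 Ef Hzs.
  destruct (eventually_and _ _ EP (eventually_and _ _ E1 (eventually_and _ _ E0 Ef)))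
    as (R0 & HR0 & H).
  assert (strip := h0_strip_bound f f1 f2 h1 h0 P P1 zs c k s1 s2 tau rho c2 N R0
    DP D0 Hf1 Hf2 Hode HP1 Hc HR0 Hc2 ltac:(lra)
    ltac:(intros z Hz; now apply (H (Cmod z) Hz)) ltac:(intros z Hz; now apply (H (Cmod z) Hz))
    ltac:(intros z Hz; now apply (H (Cmod z) Hz)) ltac:(intros z Hz; now apply (H (Cmod z) Hz)) Hzs).
  destruct strip as (Rs & HRs & strip).
  set (Q := Rmax R0 Rs). assert (HQ : R0 <= Q /\ Rs <= Q) by (split; [apply Rmax_l|apply Rmax_r]).
  assert (HQs : forall z, Q <= Cmod z -> Rabs (Re (P z)) <= 1 ->
    Cmod (h0 z) <= exp (Rpower (Cmod z) s2)).
  { intros z Hz. apply strip; [lra|reflexivity]. }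
  assert (PL : forall G, (forall z, cdiff G z) -> (forall z, Cmod (G z) = Cmod (P z)) ->
    (forall z, Rabs (Re (G z)) = Rabs (Re (P z))) ->
    exists K, forall z, Q <= Cmod z -> 1 <= Re (G z) -> Cmod (h0 z) <= exp (K * Rpower (Cmod z) s2)).
  { intros G DG EG ReG. apply (phragmen_lindelof G h0 N c1 c2 s2 tau Q); auto; try lra.
    - intros z Hz. rewrite EG. apply (H (Cmod z)); [lra|reflexivity].
    - intros z Hz. apply (H (Cmod z)); [lra|reflexivity].
    - intros z Hz E. apply HQs; [exact Hz|]. rewrite <- ReG, E, Rabs_R1. apply Rle_refl. }
  destruct (PL P DP) as (K1 & HK1); [reflexivity|reflexivity|].
  destruct (PL (fun z => RtoC (-1) * P z)%C) as (K2 & HK2).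
  { intros z. apply cdiff_mult; [apply cdiff_const|apply DP]. }
  { intros z. rewrite Cmod_mult, Cmod_R, Rabs_left by lra. ring. }
  { intros z. rewrite Re_mult. simpl. rewrite <- Rabs_Ropp. f_equal. ring. }
  exists (Rmax 1 (Rmax K1 K2)). exists Q. split; [lra|]. intros r Hr z <-.
  assert (G := Rpower_pos (Cmod z) s2).
  assert (up : forall K, K <= Rmax 1 (Rmax K1 K2) -> Cmod (h0 z) <= exp (K * Rpower (Cmod z) s2) ->
    Cmod (h0 z) <= exp (Rmax 1 (Rmax K1 K2) * Rpower (Cmod z) s2)).
  { intros K HK HB. apply Rle_trans with (1 := HB). apply exp_le_compat.
    apply Rmult_le_compat_r; lra. }
  destruct (Rle_lt_dec 1 (Re (P z))) as [X1|X1].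
  { apply up with K1; auto. eapply Rle_trans; [apply Rmax_l|apply Rmax_r]. }
  destruct (Rle_lt_dec (Re (P z)) (-1)) as [X2|X2].
  { apply up with K2; [eapply Rle_trans; [apply Rmax_r|apply Rmax_r]|].
    apply HK2; [exact Hr|]. rewrite Re_mult. simpl. lra. }
  apply up with 1; [apply Rmax_l|]. rewrite Rmult_1_l. apply HQs; [exact Hr|].
  apply Rabs_le. lra.
Qed.

Open Scope C_scope.

Theorem theorem3 (n : nat) (a b : nat -> C) (h1 h0 : C -> C) (c : R) :
  (1 <= n)%nat ->
  a n <> 0 -> b n <> 0 ->
  entire h1 -> entire h0 ->
  (exists z, h1 z <> 0) -> (exists z, h0 z <> 0) ->
  Rbar_lt (order h1) (INR n) -> Rbar_lt (order h0) (INR n) ->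
  (1 <= c)%R ->
  (exists k : C, forall z, peval a n z - RtoC c * peval b n z = k) ->
  Rbar_lt (order h1) (lower_order h0) ->
  Rbar_le (lower_order h0) (Finite (1/2)) ->
  forall f f1 f2 : C -> C,
    (forall z, is_derive f z (f1 z)) ->
    (forall z, is_derive f1 z (f2 z)) ->
    (forall z, f2 z + h1 z * cexp (peval a n z) * f1 z
                    + h0 z * cexp (peval b n z) * f z = 0) ->
    (exists z, f z <> 0) ->
    order f = p_infty.
Proof.
  intros Hn _ Hb Hh1 Hh0 _ _ _ Hord0 Hc (k & Hk) Hlow Hhalf f f1 f2 Hf1 Hf2 Hode (zs & Hzs).
  apply order_infinite. intros Hfin.
  assert (D1 := fun z => ex_derive_cdiff _ _ (Hh1 z)).
  assert (D0 := fun z => ex_derive_cdiff _ _ (Hh0 z)).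
  assert (Df := fun z => is_derive_cdiff _ _ _ (Hf1 z)).
  destruct (order_witness f _ Hfin) as (rho & Rf & _ & Hf).
  destruct (order_witness h0 _ Hord0) as (tau & Rt & Htau & Ht).
  (* The lower order of [h0] serves as [L]: [s1] eventually bounds the growth ratio of [h1] and
     still lies strictly below that lower order. *)
  destruct (order_witness h1 _ Hlow) as (s1 & R1 & Hs1 & H1).
  destruct (lower_order_witness h0 _ Hs1) as (s4 & R4 & Hs4 & Hs4' & H4).
  assert (Hs4h := Rbar_le_trans _ _ _ Hs4' Hhalf).
  simpl in Htau, Hs4, Hs4h. clear Hfin Hord0 Hlow Hhalf Hs1 Hs4'.
  destruct (growth_of_ord_ratio f rho Rf Df Hf) as (rho0 & Gf).
  destruct (growth_of_ord_ratio h0 tau Rt D0 Ht) as (tau0 & G0).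
  destruct (growth_of_ord_ratio h1 s1 R1 D1 H1) as (s10 & G1).
  (* Two exponents strictly between [s1] and [s4]: [s2] for the bound on [h0], and [s3] to absorb
     the constant [K]. Since [s4 <= 1/2 < n], also [s2 < n]. *)
  set (s2 := ((2 * s1 + s4) / 3)%R). set (s3 := ((s1 + 2 * s4) / 3)%R).
  assert (Hs : (s1 < s2 < s3 /\ s3 < s4)%R) by (unfold s2, s3; lra).
  assert (Hn1 : (1 <= INR n)%R) by (apply (le_INR 1); exact Hn).
  destruct (peval_upper b n) as (c2 & Hc2 & HU).
  assert (Hb0 := proj1 (Cmod_gt_0 _) Hb).
  destruct (coefficient_growth f f1 f2 h1 h0 (peval b n) (peval a n) zs
    c (Re k) s1 s2 tau rho (Cmod (b n) / 2) c2 (INR n)) as (K & HK); auto; try lra.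
  { intros z. apply cdiff_peval. }
  { intros z. rewrite <- (Hk z), Re_minus, Re_mult. simpl. lra. }
  { apply eventually_mono with (2 := peval_lower b n Hn Hb). intros r Hr H z Hz.
    rewrite Rpower_pow by lra. split; [now apply H|]. rewrite <- Hz. apply HU. lra. }
  assert (G3 := eventually_and _ _ HK (eventually_power K s2 s3 ltac:(lra))).
  destruct (ord_ratio_of_growth h0 s3 D0 ltac:(lra)) as (R6 & _ & H6).
  { apply eventually_mono with (2 := G3). intros r _ [Hr HKr] z Hz.
    apply Rle_trans with (1 := Hr z Hz). now apply exp_le_compat. }
  (* At a common radius the growth ratio of [h0] would be at most [s3] and at least [s4]. *)
  specialize (H6 (Rmax R6 R4) (Rmax_l _ _)). specialize (H4 (Rmax R6 R4) (Rmax_r _ _)). lra.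
Qed.
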